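(* Let $(\theta,\phi)\in U(1)\times U(1)$ with $(\theta,\phi)\neq(1,1)$ and let $k\ge1$. Then $E_k\!\left[\begin{array}{c}\theta\\ \phi\end{array}\right]$ is a modular form of weight $k$ in the sense that for every $\gamma=\left(\begin{array}{cc}a&b\\ c&d\end{array}\right)\in SL(2,\mathbb Z)$ and $\tau$ in the complex upper half plane, $$E_k\!\left(\gamma.\!\left[\begin{array}{c}\theta\\ \phi\end{array}\right]\right)\!(\gamma.\tau)=(c\tau+d)^k\,E_k\!\left[\begin{array}{c}\theta\\ \phi\end{array}\right](\tau).$$
   Context: $U(1)$ is the group of complex numbers of modulus one; $q^x=e^{2\pi ix\tau}$. With $\phi=\exp(2\pi i\lambda)$, $0\le\lambda<1$, the twisted Eisenstein series for $n\ge1$ are $$E_n\!\left[\begin{array}{c}\theta\\ \phi\end{array}\right](\tau)=-\frac{B_n(\lambda)}{n!}+\frac1{(n-1)!}\sum_{r\ge0}\frac{(r+\lambda)^{n-1}\theta^{-1}q^{r+\lambda}}{1-\theta^{-1}q^{r+\lambda}}+\frac{(-1)^n}{(n-1)!}\sum_{r\ge1}\frac{(r-\lambda)^{n-1}\theta q^{r-\lambda}}{1-\theta q^{r-\lambda}}$$ (for $(\theta,\phi)\ne(1,1)$; $0^0=1$), where the Bernoulli polynomials are defined by $\frac{e^{\lambda z}}{e^z-1}=\frac1z+\sum_{n\ge1}\frac{B_n(\lambda)}{n!}z^{n-1}$. The actions are $\gamma.\tau=\frac{a\tau+b}{c\tau+d}$ and $\gamma.\left[\begin{array}{c}\theta\\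 \phi\end{array}\right]=\left[\begin{array}{c}\theta^a\phi^b\\ \theta^c\phi^d\end{array}\right]$. *)

(* Defs.v *)
From Stdlib Require Import Reals ZArith Psatz ClassicalEpsilon.
From Coquelicot Require Import Coquelicot.

Local Open Scope R_scope.

Definition Cexp (z : C) : C :=
  (exp (Re z) * cos (Im z), exp (Re z) * sin (Im z)).

Definition CpowZ (z : C) (n : Z) : C :=
  match n with
  | Z0 => RtoC 1
  | Zpos p => Cpow z (Pos.to_nat p)
  | Zneg p => Cinv (Cpow z (Pos.to_nat p))
  end.

(* Meaningful only when the series converges, see [CSeries_unique]. *)
Definition CSeries (u : nat -> C) : C :=
  (Series (fun n => Re (u n)), Series (fun n => Im (u n))).

Lemma sum_n_C (u : nat -> C) (n : nat) :
  sum_n u n = (sum_n (fun n => Re (u n)) n, sum_n (fun n => Im (u n)) n).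
Proof.
  induction n as [|n IH].
  - rewrite !sum_O. now destruct (u 0%nat).
  - rewrite !sum_Sn, IH. now destruct (u (S n)).
Qed.

Lemma is_series_C (u : nat -> C) (l : C) :
  is_series u l <->
  is_series (fun n => Re (u n)) (Re l) /\ is_series (fun n => Im (u n)) (Im l).
Proof.
  unfold is_series; split.
  - intros H; split; apply filterlim_locally; intros eps;
    destruct (proj1 (filterlim_locally (U := C_UniformSpace) _ _) H eps) as [N HN];
    exists N; intros n Hn; specialize (HN n Hn); rewrite sum_n_C in HN; apply HN.
  - intros [H1 H2]. apply (filterlim_locally (U := C_UniformSpace)). intros eps.
    destruct (proj1 (filterlim_locally _ _) H1 eps) as [N1 HN1].
    destruct (proj1 (filterlim_locally _ _) H2 eps) as [N2 HN2].
    exists (max N1 N2). intros n Hn. rewrite sum_n_C.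
    split; [apply HN1 | apply HN2]; lia.
Qed.

Lemma CSeries_unique (u : nat -> C) (l : C) : is_series u l -> CSeries u = l.
Proof.
  intros H; apply is_series_C in H; destruct H as [H1 H2].
  unfold CSeries. rewrite (is_series_unique _ _ H1), (is_series_unique _ _ H2).
  now destruct l.
Qed.

(* [B] lists the values at [lam] of the Bernoulli polynomials: the expansion
     e^(lam z) / (e^z - 1) = 1/z + sum_(n >= 1) B_n(lam)/n! z^(n-1)
   holds in a punctured disc around 0, the term 1/z being the one of [B 0 = 1]. *)
Definition is_bernoulli (lam : R) (B : nat -> R) : Prop :=
  B 0%nat = 1 /\
  exists r : R, 0 < r /\ forall z : C, 0 < Cmod z < r ->
    is_series (fun n : nat => (RtoC (B (S n) / INR (fact (S n))) * z ^ n)%C)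
      (Cexp (RtoC lam * z) / (Cexp z - 1) - 1 / z)%C.

Definition bernoulli (n : nat) (lam : R) : R :=
  epsilon (inhabits (fun _ : nat => 0)) (is_bernoulli lam) n.

Section BernoulliExists.

Variable lam : R.

(* [btab m k] is B_k(lam)/k! for k < m and 0 for k >= m. *)
Fixpoint btab (m : nat) : nat -> R :=
  match m with
  | O => fun _ => 0
  | S p => fun k =>
      if Nat.eqb k p
      then lam ^ p / INR (fact p)
           - sum_f_R0 (fun j => btab p j / INR (fact (S (p - j)))) p
      else btab p k
  end.

Definition bcoef (n : nat) : R := btab (S n) n.

Lemma btab_lt m k : (k < m)%nat -> btab m k = bcoef k.
Proof.
  induction m as [|m IH]; [lia|]. intros Hk.
  destruct (Nat.eq_dec k m) as [->|Hne]; [reflexivity|].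
  simpl. rewrite (proj2 (Nat.eqb_neq k m) Hne). apply IH; lia.
Qed.

Lemma btab_ge m k : (m <= k)%nat -> btab m k = 0.
Proof.
  induction m as [|m IH]; [reflexivity|]. intros Hk. simpl.
  rewrite (proj2 (Nat.eqb_neq k m)) by lia. apply IH; lia.
Qed.

Lemma bcoef_eq m : bcoef m = lam ^ m / INR (fact m)
  - sum_f_R0 (fun j => btab m j / INR (fact (S (m - j)))) m.
Proof. unfold bcoef at 1; simpl. now rewrite Nat.eqb_refl. Qed.

Lemma bcoef_rec m :
  sum_f_R0 (fun j => bcoef j * / INR (fact (S (m - j)))) m = lam ^ m / INR (fact m).
Proof.
  destruct m as [|m].
  - simpl. rewrite bcoef_eq. simpl. field.
  - pose proof (bcoef_eq (S m)) as H.
    rewrite tech5 in H |- *. rewrite btab_ge in H by lia.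
    rewrite (sum_eq (fun j => btab (S m) j / INR (fact (S (S m - j))))
                    (fun j => bcoef j * / INR (fact (S (S m - j))))) in H.
    + rewrite H. rewrite Nat.sub_diag. simpl (fact 1). simpl INR.
      unfold Rdiv. lra.
    + intros i Hi. rewrite btab_lt by lia. reflexivity.
Qed.

Let K : R := 2 + 2 * Rabs lam.

Lemma INR_fact_ge1 n : 1 <= INR (fact n).
Proof. apply (le_INR 1). pose proof (lt_O_fact n). lia. Qed.

Lemma INR_fact_ge2 n : (2 <= n)%nat -> 2 <= INR (fact n).
Proof.
  intros Hn. apply (le_INR 2).
  apply (Nat.le_trans _ (fact 2)); [simpl; lia | now apply fact_le].
Qed.

Lemma bcoef_bound m : Rabs (bcoef m) <= K ^ m.
Proof.
  assert (HK : 2 <= K) by (unfold K; pose proof (Rabs_pos lam); lra).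
  induction m as [m IH] using lt_wf_ind.
  rewrite bcoef_eq. destruct m as [|m].
  { simpl. replace (1 / 1 - 0 / 1) with 1 by field. rewrite Rabs_R1. lra. }
  rewrite tech5, btab_ge by lia.
  assert (Hgeo : forall p, sum_f_R0 (fun j => K ^ j / 2) p <= K ^ (S p) / 2).
  { induction p as [|p IHp]; [simpl; lra|].
    rewrite tech5. simpl in *.
    assert (0 < K * K ^ p) by (apply (pow_lt K (S p)); lra). nra. }
  assert (H1 : Rabs (lam ^ S m / INR (fact (S m))) <= K ^ S m / 2).
  { unfold Rdiv at 1. rewrite Rabs_mult, <- RPow_abs.
    assert (Hf := INR_fact_ge1 (S m)).
    rewrite (Rabs_pos_eq (/ _)) by (left; apply Rinv_0_lt_compat; lra).
    assert (Hi : / INR (fact (S m)) <= 1)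
      by (rewrite <- Rinv_1; apply Rinv_le_contravar; lra).
    assert (Hp : 0 <= Rabs lam ^ S m) by (apply pow_le, Rabs_pos).
    assert (Hl : Rabs lam ^ S m <= (K / 2) * K ^ m).
    { simpl. apply Rmult_le_compat; [apply Rabs_pos | apply pow_le, Rabs_pos | |].
      - unfold K; lra.
      - apply pow_incr. split; [apply Rabs_pos|]. unfold K.
        pose proof (Rabs_pos lam); lra. }
    assert (0 <= / INR (fact (S m))) by (left; apply Rinv_0_lt_compat; lra).
    simpl (K ^ S m). nra. }
  assert (H2 : Rabs (sum_f_R0 (fun j => btab (S m) j / INR (fact (S (S m - j)))) m)
               <= K ^ S m / 2).
  { eapply Rle_trans; [apply Rabs_triang_gen|].
    eapply Rle_trans; [|apply Hgeo].
    apply sum_Rle. intros j Hj. rewrite btab_lt by lia.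
    unfold Rdiv. rewrite Rabs_mult.
    assert (Hf : 2 <= INR (fact (S (S m - j)))) by (apply INR_fact_ge2; lia).
    rewrite (Rabs_pos_eq (/ _)) by (left; apply Rinv_0_lt_compat; lra).
    apply Rmult_le_compat; [apply Rabs_pos | | apply IH; lia |].
    - left; apply Rinv_0_lt_compat; lra.
    - apply Rinv_le_contravar; lra. }
  unfold Rdiv at 3. rewrite Rmult_0_l, Rplus_0_r.
  eapply Rle_trans; [apply Rabs_triang|]. rewrite Rabs_Ropp. lra.
Qed.

Lemma Rabs_Re_le z : Rabs (Re z) <= Cmod z.
Proof. eapply Rle_trans; [apply Rmax_l | apply (Rmax_Cmod z)]. Qed.

Lemma Rabs_Im_le z : Rabs (Im z) <= Cmod z.
Proof. eapply Rle_trans; [apply Rmax_r | apply (Rmax_Cmod z)]. Qed.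

Lemma is_series_Cmult (a b : nat -> C) (la lb : C) :
  is_series a la -> is_series b lb ->
  ex_series (fun n => Cmod (a n)) -> ex_series (fun n => Cmod (b n)) ->
  is_series (fun n => sum_n (fun k => (a k * b (n - k)%nat)%C) n) (la * lb)%C.
Proof.
  intros Ha Hb Xa Xb.
  apply is_series_C in Ha; apply is_series_C in Hb.
  destruct Ha as [Ha1 Ha2], Hb as [Hb1 Hb2].
  assert (HX : forall u : nat -> C, ex_series (fun n => Cmod (u n)) ->
     ex_series (fun n => Rabs (Re (u n))) /\ ex_series (fun n => Rabs (Im (u n)))).
  { intros u Hu; split; refine (ex_series_le (V := R_CompleteNormedModule) _ _ _ Hu);
    intros n; (eapply Rle_trans; [apply Req_le, Rabs_Rabsolu|]);
    [apply Rabs_Re_le | apply Rabs_Im_le]. }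
  destruct (HX _ Xa) as [Xa1 Xa2], (HX _ Xb) as [Xb1 Xb2].
  pose proof (is_series_mult _ _ _ _ Ha1 Hb1 Xa1 Xb1) as H11.
  pose proof (is_series_mult _ _ _ _ Ha2 Hb2 Xa2 Xb2) as H22.
  pose proof (is_series_mult _ _ _ _ Ha1 Hb2 Xa1 Xb2) as H12.
  pose proof (is_series_mult _ _ _ _ Ha2 Hb1 Xa2 Xb1) as H21.
  apply is_series_C; split.
  - rewrite re_mult.
    eapply is_series_ext; [|exact (is_series_minus _ _ _ _ H11 H22)].
    intros n. rewrite sum_n_C; simpl. rewrite sum_n_Reals.
    symmetry. etransitivity; [apply minus_sum|].
    reflexivity.
  - rewrite im_mult.
    eapply is_series_ext; [|exact (is_series_plus _ _ _ _ H12 H21)].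
    intros n. rewrite sum_n_C; simpl. rewrite sum_n_Reals. symmetry. apply plus_sum.
Qed.

Lemma is_series_exp_R (x : R) :
  is_series (fun n => / INR (fact n) * x ^ n) (exp x).
Proof. exact (proj1 (is_pseries_R _ _ _) (is_exp_Reals x)). Qed.

Lemma ex_series_exp_abs (z : C) :
  ex_series (fun n => Cmod (z ^ n * RtoC (/ INR (fact n)))%C).
Proof.
  exists (exp (Cmod z)).
  eapply is_series_ext; [|apply is_series_exp_R].
  intros n. simpl. rewrite Rmult_comm.
  rewrite Cmod_mult, Cmod_pow, Cmod_R, Rabs_pos_eq; [reflexivity|].
  left; apply Rinv_0_lt_compat. pose proof (INR_fact_ge1 n); lra.
Qed.

Lemma Cexp_plus (z w : C) : Cexp (z + w) = (Cexp z * Cexp w)%C.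
Proof.
  destruct z as [x y], w as [x' y']. unfold Cexp, Cmult; simpl.
  rewrite exp_plus, cos_plus, sin_plus. f_equal; ring.
Qed.

Lemma Ci_pow_even n : (Ci ^ (2 * n))%C = RtoC ((-1) ^ n).
Proof.
  induction n as [|n IH]; [reflexivity|].
  replace (2 * S n)%nat with (S (S (2 * n))) by lia.
  rewrite !Cpow_S, IH. unfold Ci, Cmult, RtoC; simpl. f_equal; ring.
Qed.

Lemma is_series_0 : is_series (fun _ : nat => 0) 0.
Proof.
  assert (H : is_series (fun n => 0 * (/ INR (fact n) * 0 ^ n)) (0 * exp 0))
    by exact (is_series_scal 0 _ _ (is_series_exp_R 0)).
  rewrite Rmult_0_l in H.
  eapply is_series_ext; [|exact H]. intros n. apply Rmult_0_l.
Qed.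

Ltac ring_R := match goal with |- ?a = ?b => change (@eq R a b) end; ring.
Ltac ring_C := match goal with |- ?a = ?b => change (@eq C a b) end; ring.

Lemma is_series_exp_imag (y : R) :
  is_series (fun n => ((Ci * RtoC y) ^ n * RtoC (/ INR (fact n)))%C) (Cexp (Ci * RtoC y)).
Proof.
  assert (Hodd : forall n, (Ci ^ (2 * n + 1))%C = (Ci * RtoC ((-1) ^ n))%C).
  { intros n. rewrite Nat.add_1_r, Cpow_S, Ci_pow_even. reflexivity. }
  assert (Hterm : forall n, ((Ci * RtoC y) ^ n * RtoC (/ INR (fact n)))%C =
     (Re (Ci ^ n)%C / INR (fact n) * y ^ n, Im (Ci ^ n)%C / INR (fact n) * y ^ n)).
  { intros n. rewrite Cpow_mult_l, <- RtoC_pow. destruct (Ci ^ n)%C as [p q].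
    unfold Cmult, RtoC, Re, Im, Rdiv; simpl. f_equal; ring. }
  assert (Hexp : Cexp (Ci * RtoC y) = (cos y, sin y)).
  { unfold Cexp, Ci, Cmult, RtoC, Re, Im; simpl.
    replace (0 * y - 1 * 0) with 0 by ring.
    replace (0 * 0 + 1 * y) with y by ring.
    rewrite exp_0. f_equal; ring. }
  rewrite Hexp. apply is_series_C.
  change (Re (cos y, sin y)) with (cos y).
  change (Im (cos y, sin y)) with (sin y). split.
  - assert (H : is_pseries (fun n => Re (Ci ^ n)%C / INR (fact n)) y (cos y + y * 0)).
    { apply is_pseries_odd_even; apply (proj2 (is_pseries_R _ _ _)).
      - unfold cos; destruct (exist_cos y²) as [l Hl]. unfold cos_in in Hl.
        apply is_series_Reals in Hl. eapply is_series_ext; [|exact Hl].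
        intros n. cbv beta. rewrite Ci_pow_even, Rsqr_pow2. reflexivity.
      - eapply is_series_ext; [|exact is_series_0].
        intros n. cbv beta. rewrite Hodd.
        unfold Ci, RtoC, Cmult, Re, Rdiv; cbn [fst snd]. ring_R. }
    rewrite Rmult_0_r, Rplus_0_r in H. apply (proj1 (is_pseries_R _ _ _)) in H.
    eapply is_series_ext; [|exact H].
    intros n. cbv beta. now rewrite Hterm.
  - assert (H : is_pseries (fun n => Im (Ci ^ n)%C / INR (fact n)) y (0 + sin y)).
    { unfold sin; destruct (exist_sin y²) as [l Hl].
      apply is_pseries_odd_even; apply (proj2 (is_pseries_R _ _ _)).
      - eapply is_series_ext; [|exact is_series_0].
        intros n. cbv beta. rewrite Ci_pow_even.
        unfold RtoC, Im, Rdiv; cbn [fst snd]. ring_R.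
      - unfold sin_in in Hl.
        apply is_series_Reals in Hl. eapply is_series_ext; [|exact Hl].
        intros n. cbv beta. rewrite Hodd, Rsqr_pow2. unfold sin_n.
        replace (Im (Ci * RtoC ((-1) ^ n))%C) with ((-1) ^ n)
          by (unfold Ci, RtoC, Cmult, Im; cbn [fst snd]; ring).
        reflexivity. }
    rewrite Rplus_0_l in H. apply (proj1 (is_pseries_R _ _ _)) in H.
    eapply is_series_ext; [|exact H].
    intros n. cbv beta. now rewrite Hterm.
Qed.

Lemma sum_n_Cmult (c : C) (u : nat -> C) (n : nat) :
  sum_n (fun k => (c * u k)%C) n = (c * sum_n u n)%C.
Proof. exact (sum_n_mult_l (K := C_Ring) c u n). Qed.

Lemma sum_n_RtoC (u : nat -> R) (n : nat) :
  sum_n (fun k => RtoC (u k)) n = RtoC (sum_n u n).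
Proof.
  induction n as [|n IH]; [now rewrite !sum_O|].
  rewrite !sum_Sn, IH. symmetry. apply RtoC_plus.
Qed.

Lemma RtoC_INR_neq0 n : RtoC (INR (S n)) <> 0.
Proof. intros H. apply RtoC_inj in H. now apply (not_0_INR (S n)). Qed.

Lemma Cexp_term_S (u : C) k :
  (RtoC (INR (S k)) * (u ^ S k * RtoC (/ INR (fact (S k)))))%C =
  (u * (u ^ k * RtoC (/ INR (fact k))))%C.
Proof.
  assert (H : INR (S k) * / INR (fact (S k)) = / INR (fact k)).
  { rewrite fact_simpl, mult_INR. field.
    split; [apply INR_fact_neq_0 | now apply not_0_INR]. }
  rewrite <- H, RtoC_mult, Cpow_S. ring.
Qed.

Lemma Cbinomial_exp (u v : C) (m : nat) :
  ((u + v) ^ m * RtoC (/ INR (fact m)))%C =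
  sum_n (fun k => (u ^ k * RtoC (/ INR (fact k)) *
                   (v ^ (m - k) * RtoC (/ INR (fact (m - k)))))%C) m.
Proof.
  induction m as [|m IH].
  { rewrite sum_O. simpl. rewrite Rinv_1. ring. }
  set (e := fun (w : C) k => (w ^ k * RtoC (/ INR (fact k)))%C) in *.
  assert (He : forall w k, (RtoC (INR (S k)) * e w (S k))%C = (w * e w k)%C)
    by (intros; apply Cexp_term_S).
  change (e (u + v)%C (S m) = sum_n (fun k => (e u k * e v (S m - k)%nat)%C) (S m)).
  change (e (u + v)%C m = sum_n (fun k => (e u k * e v (m - k)%nat)%C) m) in IH.
  assert (Hinj : forall x y, (RtoC (INR (S m)) * x)%C = (RtoC (INR (S m)) * y)%C -> x = y).
  { intros x y H. pose proof (RtoC_INR_neq0 m) as Hm.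
    replace x with (/ RtoC (INR (S m)) * (RtoC (INR (S m)) * x))%C by (field; exact Hm).
    rewrite H. field. exact Hm. }
  apply Hinj. rewrite He, IH, <- !sum_n_Cmult.
  transitivity (sum_n (fun k => (RtoC (INR k) * e u k * e v (S m - k)%nat)%C) (S m) +
                sum_n (fun k => (e u k * (RtoC (INR (S m - k)) * e v (S m - k)%nat))%C) (S m))%C.
  2:{ etransitivity; [symmetry; exact (sum_n_plus (G := C_AbelianGroup) _ _ _)|].
      apply sum_n_ext_loc. intros k Hk.
      rewrite minus_INR, RtoC_minus by exact Hk. 
      unfold plus; cbn -[e minus INR Cpow]. ring_C. }
  assert (HA : forall t : nat -> C, t 0%nat = 0 ->
            sum_n t (S m) = sum_n (fun k => t (S k)) m).
  { intros t Ht. unfold sum_n. rewrite sum_Sn_m by lia.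
    rewrite <- sum_n_m_S, Ht. apply Cplus_0_l. }
  assert (HB : forall t : nat -> C, t (S m) = 0 -> sum_n t (S m) = sum_n t m).
  { intros t Ht. rewrite sum_Sn, Ht. apply Cplus_0_r. }
  rewrite HA by (simpl; ring).
  rewrite HB by (rewrite Nat.sub_diag; simpl; ring).
  etransitivity; [|exact (sum_n_plus (G := C_AbelianGroup) _ _ _)].
  apply sum_n_ext_loc. intros k Hk. cbv beta. rewrite He.
  replace (S m - k)%nat with (S (m - k)) by lia. rewrite He.
  simpl (S m - S k)%nat. unfold plus; cbn -[e minus INR Cpow]. ring_C.
Qed.

Lemma is_series_exp (z : C) :
  is_series (fun n => (z ^ n * RtoC (/ INR (fact n)))%C) (Cexp z).
Proof.
  destruct z as [x y].
  assert (Hxy : (x, y) = (RtoC x + Ci * RtoC y)%C)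
    by (unfold Ci, RtoC, Cmult, Cplus; simpl; f_equal; ring).
  rewrite Hxy, Cexp_plus.
  assert (Hx : is_series (fun n => (RtoC x ^ n * RtoC (/ INR (fact n)))%C)
                 (Cexp (RtoC x))).
  { assert (Hterm : forall n, (RtoC x ^ n * RtoC (/ INR (fact n)))%C
                              = RtoC (x ^ n * / INR (fact n)))
      by (intros n; now rewrite <- RtoC_pow, <- RtoC_mult).
    assert (Hexp : Cexp (RtoC x) = RtoC (exp x)).
    { unfold Cexp, RtoC; simpl. now rewrite cos_0, sin_0, Rmult_1_r, Rmult_0_r. }
    rewrite Hexp. apply is_series_C.
    change (Re (RtoC (exp x))) with (exp x).
    change (Im (RtoC (exp x))) with 0. split.
    - eapply is_series_ext; [|apply is_series_exp_R].
      intros n. cbv beta. rewrite Hterm. apply Rmult_comm.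
    - eapply is_series_ext; [|exact is_series_0].
      intros n. now rewrite Hterm. }
  refine (is_series_ext _ _ _ _ (is_series_Cmult _ _ _ _ Hx (is_series_exp_imag y)
            (ex_series_exp_abs _) (ex_series_exp_abs _))).
  intros n.
  symmetry. apply Cbinomial_exp.
Qed.

Lemma Cexp_neq0 z : Cexp z <> 0.
Proof.
  intros H.
  assert (H1 : (Cexp z * Cexp (- z))%C = 1).
  { rewrite <- Cexp_plus. replace (z + - z)%C with (RtoC 0) by ring.
    unfold Cexp, RtoC; simpl. rewrite exp_0, cos_0, sin_0. f_equal; ring. }
  rewrite H, Cmult_0_l in H1. apply RtoC_inj in H1. lra.
Qed.

Lemma is_series_Cscal (c : C) (u : nat -> C) (l : C) :
  is_series u l -> is_series (fun n => (c * u n)%C) (c * l)%C.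
Proof. exact (is_series_scal (K := C_AbsRing) (V := C_NormedModule) c u l). Qed.

Lemma is_series_Cshift (u : nat -> C) (l : C) :
  is_series u l -> is_series (fun n => u (S n)) (l - u 0%nat)%C.
Proof.
  intros H. apply (is_series_incr_1 (K := C_AbsRing) (V := C_NormedModule)).
  refine (eq_ind l (fun x => is_series u x) H _ _).
  unfold plus; cbn -[Cminus]. ring_C.
Qed.

Lemma is_bernoulli_exists : exists B, is_bernoulli lam B.
Proof.
  assert (HK : 2 <= K) by (unfold K; pose proof (Rabs_pos lam); lra).
  exists (fun n => bcoef n * INR (fact n)). split.
  { pose proof (bcoef_rec 0) as H. simpl in H |- *. lra. }
  exists (/ K). split; [apply Rinv_0_lt_compat; lra|].
  intros z [Hz0 HzK].
  assert (Hz : z <> 0) by now apply Cmod_gt_0.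
  assert (HzK1 : K * Cmod z < 1).
  { replace 1 with (K * / K) by (field; lra). apply Rmult_lt_compat_l; lra. }
  set (f := fun n => (RtoC (bcoef n) * z ^ n)%C).
  set (g := fun n => (RtoC (/ INR (fact (S n))) * z ^ n)%C).
  assert (Xf : ex_series (fun n => Cmod (f n))).
  { refine (ex_series_le (V := R_CompleteNormedModule) _ (fun n => (K * Cmod z) ^ n) _ _).
    - intros n. eapply Rle_trans; [apply Req_le, Rabs_pos_eq, Cmod_ge_0|].
      unfold f. rewrite Cmod_mult, Cmod_R, Cmod_pow, Rpow_mult_distr.
      apply Rmult_le_compat_r; [apply pow_le, Cmod_ge_0 | apply bcoef_bound].
    - apply ex_series_geom. rewrite Rabs_pos_eq; [exact HzK1|].
      apply Rmult_le_pos; lra. }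
  assert (Xg : ex_series (fun n => Cmod (g n))).
  { refine (ex_series_le (V := R_CompleteNormedModule) _ (fun n => Cmod z ^ n) _ _).
    - intros n. eapply Rle_trans; [apply Req_le, Rabs_pos_eq, Cmod_ge_0|].
      unfold g. rewrite Cmod_mult, Cmod_R, Cmod_pow.
      pose proof (INR_fact_ge1 (S n)) as Hf.
      rewrite Rabs_pos_eq by (left; apply Rinv_0_lt_compat; lra).
      rewrite <- (Rmult_1_l (Cmod z ^ n)) at 2.
      apply Rmult_le_compat_r; [apply pow_le, Cmod_ge_0 |].
      rewrite <- Rinv_1. apply Rinv_le_contravar; lra.
    - apply ex_series_geom. rewrite Rabs_pos_eq by lra. nra. }
  assert (Ef : ex_series f).
  { refine (ex_series_le (V := C_CompleteNormedModule) _ (fun n => Cmod (f n)) _ Xf).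
    intros n. apply Rle_refl. }
  destruct Ef as [F HF].
  assert (HG : is_series g ((Cexp z - 1) / z)%C).
  { pose proof (is_series_Cscal (/ z)%C _ _ (is_series_Cshift _ _ (is_series_exp z))) as H.
    replace ((Cexp z - 1) / z)%C
      with (/ z * (Cexp z - z ^ 0 * RtoC (/ INR (fact 0))))%C.
    - eapply is_series_ext; [|exact H].
      intros n. cbv beta. unfold g. rewrite Cpow_S.
      match goal with |- ?a = ?b => change (@eq C a b) end. field. exact Hz.
    - simpl. rewrite Rinv_1. field. exact Hz. }
  assert (HFG : (F * ((Cexp z - 1) / z))%C = Cexp (RtoC lam * z)).
  { pose proof (is_series_Cmult _ _ _ _ HF HG Xf Xg) as H.
    pose proof (is_series_exp (RtoC lam * z)) as H'.
    rewrite <- (CSeries_unique _ _ H), <- (CSeries_unique _ _ H').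
    unfold CSeries.
    assert (Hn : forall n, sum_n (fun k => (f k * g (n - k)%nat)%C) n =
                ((RtoC lam * z) ^ n * RtoC (/ INR (fact n)))%C).
    { intros n.
      transitivity (sum_n (fun k => (z ^ n * RtoC (bcoef k * / INR (fact (S (n - k)))))%C) n).
      - apply sum_n_ext_loc. intros k Hk. unfold f, g.
        assert (Hzn : (z ^ n)%C = (z ^ k * z ^ (n - k))%C)
          by (rewrite <- Cpow_add_r; f_equal; lia).
        rewrite Hzn, RtoC_mult. ring_C.
      - rewrite sum_n_Cmult, sum_n_RtoC, sum_n_Reals, bcoef_rec.
        rewrite Cpow_mult_l, <- RtoC_pow. unfold Rdiv. rewrite RtoC_mult. ring_C. }
    f_equal; apply Series_ext; intros n; now rewrite Hn. }
  assert (Hd : (Cexp z - 1)%C <> 0).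
  { intros Hd. apply (Cexp_neq0 (RtoC lam * z)). rewrite <- HFG, Hd.
    field. exact Hz. }
  replace (Cexp (RtoC lam * z) / (Cexp z - 1) - 1 / z)%C with (/ z * (F - f 0%nat))%C.
  - eapply is_series_ext; [|exact (is_series_Cscal _ _ _ (is_series_Cshift _ _ HF))].
    intros n. cbv beta. unfold f.
    replace (bcoef (S n) * INR (fact (S n)) / INR (fact (S n))) with (bcoef (S n))
      by (field; apply INR_fact_neq_0).
    rewrite Cpow_S. match goal with |- ?a = ?b => change (@eq C a b) end.
    field. exact Hz.
  - assert (H0 : f 0%nat = 1).
    { unfold f. replace (bcoef 0) with 1; [simpl; ring|].
      pose proof (bcoef_rec 0) as H. simpl in H. lra. }
    rewrite H0, <- HFG. field. now split.
Qed.

End BernoulliExists.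

Lemma bernoulliP (lam : R) : is_bernoulli lam (fun n => bernoulli n lam).
Proof.
  exact (epsilon_spec (inhabits (fun _ : nat => 0)) (is_bernoulli lam)
           (is_bernoulli_exists lam)).
Qed.

Definition is_twist_arg (phi : C) (lam : R) : Prop :=
  0 <= lam < 1 /\ phi = Cexp (2 * PI * Ci * lam)%C.

Definition twist_arg (phi : C) : R := epsilon (inhabits 0) (is_twist_arg phi).

Lemma Cexp_2PI (t : R) : Cexp (2 * PI * Ci * t)%C = (cos (2 * PI * t), sin (2 * PI * t)).
Proof.
  unfold Cexp, Ci, RtoC, Cmult, Re, Im; cbn [fst snd].
  replace (((2 * PI - 0 * 0) * 0 - (2 * 0 + 0 * PI) * 1) * t -
           ((2 * PI - 0 * 0) * 1 + (2 * 0 + 0 * PI) * 0) * 0) with 0 by ring.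
  rewrite exp_0, !Rmult_1_l. f_equal; f_equal; ring.
Qed.

Lemma twist_argP (phi : C) : Cmod phi = 1 -> is_twist_arg phi (twist_arg phi).
Proof.
  intros H. apply (epsilon_spec (inhabits 0) (is_twist_arg phi)). destruct phi as [x y].
  assert (Hxy : x² + y² = 1).
  { pose proof (Cmod2_alt (x, y)) as H2. rewrite H in H2. simpl in H2.
    unfold Rsqr. lra. }
  assert (Hx : -1 <= x <= 1) by (unfold Rsqr in Hxy; nra).
  pose proof PI_RGT_0 as Hpi. pose proof (acos_bound x) as Hb.
  assert (Hs : sin (acos x) = Rabs y).
  { rewrite sin_acos by exact Hx. rewrite <- sqrt_Rsqr_abs. f_equal. lra. }
  pose proof (cos_acos x Hx) as Hc.
  destruct (Rle_lt_dec 0 y) as [Hy|Hy].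
  - exists (acos x / (2 * PI)). split.
    + split; [apply Rdiv_le_0_compat; lra|]. apply Rlt_div_l; lra.
    + rewrite Cexp_2PI. replace (2 * PI * (acos x / (2 * PI))) with (acos x) by (field; lra).
      rewrite Hc, Hs, Rabs_pos_eq by exact Hy. reflexivity.
  - assert (Ha : 0 < acos x).
    { destruct (proj1 Hb) as [Ha|Ha]; [exact Ha|].
      rewrite <- Ha, sin_0, Rabs_left in Hs by exact Hy. lra. }
    exists (1 - acos x / (2 * PI)).
    assert (Hq : 0 < acos x / (2 * PI) <= 1)
      by (split; [apply Rdiv_lt_0_compat; lra | apply Rle_div_l; lra]).
    split; [lra|]. rewrite Cexp_2PI.
    replace (2 * PI * (1 - acos x / (2 * PI))) with (- acos x + 2 * PI) by (field; lra).
    rewrite cos_plus, sin_plus, cos_2PI, sin_2PI, cos_neg, sin_neg, Hc, Hs, Rabs_left by exact Hy.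
    f_equal; ring.
Qed.

Definition qpow (tau : C) (x : R) : C := Cexp (2 * PI * Ci * x * tau)%C.

(* A pair [(theta, phi) : C * C] stands for the column [theta; phi]. The second
   sum is indexed by r = s + 1 with s >= 0; [x ^ 0 = 1] for every x, 0 included. *)
Definition Eis (n : nat) (chi : C * C) (tau : C) : C :=
  let (theta, phi) := chi in
  let lam := twist_arg phi in
  ( - RtoC (bernoulli n lam / INR (fact n))
    + RtoC (/ INR (fact (n - 1))) *
      CSeries (fun r : nat =>
        RtoC ((INR r + lam) ^ (n - 1)) * (/ theta * qpow tau (INR r + lam))
        / (1 - / theta * qpow tau (INR r + lam)))
    + RtoC ((-1) ^ n / INR (fact (n - 1))) *
      CSeries (fun s : nat =>
        RtoC ((INR (S s) - lam) ^ (n - 1)) * (theta * qpow tau (INR (S s) - lam))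
        / (1 - theta * qpow tau (INR (S s) - lam))) )%C.

Record SL2Z : Type := mkSL2Z {
  sl_a : Z; sl_b : Z; sl_c : Z; sl_d : Z;
  sl_det : (sl_a * sl_d - sl_b * sl_c = 1)%Z
}.

Definition automorphy (g : SL2Z) (tau : C) : C :=
  (RtoC (IZR (sl_c g)) * tau + RtoC (IZR (sl_d g)))%C.

Definition moebius (g : SL2Z) (tau : C) : C :=
  ((RtoC (IZR (sl_a g)) * tau + RtoC (IZR (sl_b g))) / automorphy g tau)%C.

Definition act_twist (g : SL2Z) (chi : C * C) : C * C :=
  let (theta, phi) := chi in
  ((CpowZ theta (sl_a g) * CpowZ phi (sl_b g))%C,
   (CpowZ theta (sl_c g) * CpowZ phi (sl_d g))%C).

(* Main.v *)
Require Import Defs.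
From Stdlib Require Import Reals ZArith.
From Coquelicot Require Import Coquelicot.
From Stdlib Require Import Psatz ClassicalEpsilon.

(* The numbers - E_n(tau) are the Taylor coefficients at z = 0 of P(z) - 1/z, where
   P(z) = - sum_(n in Z + lam) e^(n z) / (1 - theta^(-1) q^n), a sum convergent for
   - 2 pi Im tau < Re z < 0, extends to a meromorphic function with simple poles of
   residue 1 at the lattice 2 pi i (Z tau + Z), and P(z + 2 pi i tau) = theta P(z),
   P(z + 2 pi i) = phi P(z). Let P' be P for the inverted data (phi^(-1), theta) and
   - 1/tau. Then (1/tau) P'(z/tau) has the same poles and the same multipliers, so
   its difference G with P is entire and |G| is doubly periodic; by the maximum
   principle G is constant, and it vanishes because a multiplier is not 1.
   Comparing Taylor coefficients gives the transformation under - 1/tau for all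
   weights at once, including 1 and 2, where the lattice sums converge only
   conditionally. The translations tau -> tau + m are termwise, and Euclid's
   algorithm does the rest. *)

Local Open Scope R_scope.

(** The argument never leaves a bounded region. Write z = x (2 pi i tau) + y (2 pi i). The square
    |x|, |y| < 1 lies in the strip |Re z| < 2 pi Im tau, where the one-sided sums converge, and it
    contains a single lattice point, 0; after division by tau the same is true for - 1/tau. So
    nothing has to be continued to the plane, the one pole is cancelled by working with regularised
    functions, and the square still contains a whole period parallelogram with a margin, which is
    all that the maximum principle consumes. Analyticity means possession of a local power series:
    the coefficients are the objects of interest, and the maximum principle can be read off the
    first nonconstant one. The inverted data are forced. Division by tau sends the period 2 pi i tau
    to 2 pi i, and 2 pi i to minus the period 2 pi i (- 1/tau); hence the two multipliers change
    places and one of them is inverted. The condition on (theta, phi) is needed already for the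
    definition of the sums: it keeps every denominator 1 - theta^(-1) q^(r + lam) away from 0. *)

Ltac eqC := match goal with |- ?a = ?b => change (@eq C a b) end.
Ltac eqR := match goal with |- ?a = ?b => change (@eq R a b) end.

(** * Convergence of complex series; modulus of the exponential *)

Lemma Cmod_is_series_le (u : nat -> C) (b : nat -> R) (l : C) (B : R) :
  (forall n, Cmod (u n) <= b n) -> is_series u l -> is_series b B -> Cmod l <= B.
Proof.
  intros Hub Hu Hb.
  assert (H : Rbar_le (Finite (Cmod l)) (Finite B)); [|exact H].
  refine (is_lim_seq_le (fun n => Cmod (sum_n u n)) (sum_n b) (Cmod l) B _ _ Hb).
  - intros n. eapply Rle_trans; [exact (norm_sum_n_m (V := C_NormedModule) u 0 n)|].
    apply sum_n_m_le. exact Hub.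
  - exact (filterlim_comp _ _ _ _ _ _ _ _ Hu (filterlim_norm (V := C_NormedModule) l)).
Qed.

Lemma CSeries_correct (u : nat -> C) (b : nat -> R) :
  (forall n, Cmod (u n) <= b n) -> ex_series b -> is_series u (CSeries u).
Proof.
  intros Hub Hb.
  destruct (ex_series_le (V := C_CompleteNormedModule) u b Hub Hb) as [l Hl].
  rewrite (CSeries_unique u l); exact Hl.
Qed.

Lemma CSeries_ext (u v : nat -> C) : (forall n, u n = v n) -> CSeries u = CSeries v.
Proof. intros H. unfold CSeries. f_equal; apply Series_ext; intros n; now rewrite H. Qed.

Lemma is_series_Cplus (u v : nat -> C) (a b : C) :
  is_series u a -> is_series v b -> is_series (fun n => (u n + v n)%C) (a + b)%C.
Proof. exact (is_series_plus (K := C_AbsRing) (V := C_NormedModule) u v a b). Qed.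

Lemma is_series_C_ext (u v : nat -> C) (a b : C) :
  (forall n, u n = v n) -> a = b -> is_series u a -> is_series v b.
Proof. intros H <-. now apply is_series_ext. Qed.

Lemma Cmod_exp_term (z : C) (n : nat) :
  Cmod (z ^ n * RtoC (/ INR (fact n)))%C = / INR (fact n) * Cmod z ^ n.
Proof.
  rewrite Cmod_mult, Cmod_pow, Cmod_R, Rabs_pos_eq; [ring|].
  left; apply Rinv_0_lt_compat, INR_fact_lt_0.
Qed.

Lemma Cmod_Cexp (z : C) : Cmod (Cexp z) = exp (Re z).
Proof.
  unfold Cexp, Cmod; simpl.
  replace (_ + _) with (exp (Re z) * exp (Re z)).
  - apply sqrt_square. left; apply exp_pos.
  - pose proof (sin2_cos2 (Im z)) as H. unfold Rsqr in H.
    transitivity (exp (Re z) * exp (Re z) *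
      (sin (Im z) * sin (Im z) + cos (Im z) * cos (Im z))); [rewrite H|]; ring.
Qed.

Lemma Cexp_0 : Cexp 0 = 1.
Proof. unfold Cexp, RtoC; simpl. rewrite exp_0, cos_0, sin_0. f_equal; ring. Qed.

Lemma Cexp_opp z : Cexp (- z) = (/ Cexp z)%C.
Proof.
  assert (H : (Cexp (- z) * Cexp z)%C = 1).
  { rewrite <- Cexp_plus, <- Cexp_0. f_equal. ring. }
  replace (Cexp (- z)) with (Cexp (- z) * Cexp z * / Cexp z)%C.
  - rewrite H. ring.
  - field. apply Cexp_neq0.
Qed.

(** * Local power series expansions *)

(** The coefficients are part of the predicate because those at 0 will be the Eisenstein series
    themselves. Only plain convergence on some disc is asked; growth bounds and absolute convergence
    are derived. *)
Definition expands (f : C -> C) (z0 : C) (a : nat -> C) : Prop :=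
  exists r, 0 < r /\ forall h, Cmod h < r ->
    is_series (fun n => (a n * h ^ n)%C) (f (z0 + h)%C).

Definition analytic_at (f : C -> C) (z0 : C) : Prop := exists a, expands f z0 a.

Lemma is_series_at_0 (a : nat -> C) : is_series (fun n => (a n * 0 ^ n)%C) (a 0%nat).
Proof.
  apply (is_series_decr_1 (K := C_AbsRing) (V := C_NormedModule)).
  apply (is_series_C_ext (fun n => (0 * (a n * RtoC 0))%C) _ (0 * 0)%C).
  - intros n. rewrite Cpow_S. eqC. ring.
  - unfold plus, opp; simpl. rewrite Cmult_1_r. eqC. ring.
  - assert (H : is_series (fun _ : nat => RtoC 0) (RtoC 0)).
    { apply is_series_C. split; apply is_series_0. }
    apply is_series_Cscal. apply (is_series_C_ext (fun _ => RtoC 0) _ 0%C); trivial.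
    intros n. eqC. ring.
Qed.

Lemma expands_value f z0 a : expands f z0 a -> f z0 = a 0%nat.
Proof.
  intros [r [Hr H]]. specialize (H 0%C). rewrite Cmod_0 in H. specialize (H Hr).
  rewrite Cplus_0_r in H.
  rewrite <- (CSeries_unique _ _ H). apply CSeries_unique, is_series_at_0.
Qed.

Lemma expands_ext_loc f g z0 a r : 0 < r ->
  (forall h, Cmod h < r -> f (z0 + h)%C = g (z0 + h)%C) ->
  expands f z0 a -> expands g z0 a.
Proof.
  intros Hr Hfg [r' [Hr' H]]. exists (Rmin r r'). split; [now apply Rmin_pos|].
  intros h Hh. rewrite <- Hfg.
  - apply H. eapply Rlt_le_trans; [exact Hh|apply Rmin_r].
  - eapply Rlt_le_trans; [exact Hh|apply Rmin_l].
Qed.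

Lemma expands_ext f g z0 a : (forall z, f z = g z) -> expands f z0 a -> expands g z0 a.
Proof. intros H. apply (expands_ext_loc f g z0 a 1); [lra|]. intros; apply H. Qed.

Lemma expands_coef_ext f z0 a b : (forall n, a n = b n) -> expands f z0 a -> expands f z0 b.
Proof.
  intros Hab [r [Hr H]]. exists r. split; [exact Hr|]. intros h Hh.
  eapply is_series_C_ext; [|reflexivity|exact (H h Hh)]. intros n. cbv beta. now rewrite Hab.
Qed.

Lemma expands_plus f g z0 a b : expands f z0 a -> expands g z0 b ->
  expands (fun z => f z + g z)%C z0 (fun n => a n + b n)%C.
Proof.
  intros [r [Hr H]] [r' [Hr' H']]. exists (Rmin r r'). split; [now apply Rmin_pos|].
  intros h Hh.
  assert (H1 : Cmod h < r) by (eapply Rlt_le_trans; [exact Hh|apply Rmin_l]).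
  assert (H2 : Cmod h < r') by (eapply Rlt_le_trans; [exact Hh|apply Rmin_r]).
  eapply is_series_C_ext; [| |exact (is_series_Cplus _ _ _ _ (H h H1) (H' h H2))];
    [intros n; cbv beta; ring|ring].
Qed.

Lemma expands_scal c f z0 a : expands f z0 a ->
  expands (fun z => c * f z)%C z0 (fun n => c * a n)%C.
Proof.
  intros [r [Hr H]]. exists r. split; [exact Hr|]. intros h Hh.
  eapply is_series_C_ext; [| |exact (is_series_Cscal c _ _ (H h Hh))];
    [intros n; cbv beta; ring|ring].
Qed.

Lemma expands_comp_scal c f z0 a : expands f (c * z0)%C a ->
  expands (fun z => f (c * z)%C) z0 (fun n => a n * c ^ n)%C.
Proof.
  intros [r [Hr H]].
  assert (Hc : 0 < 1 + Cmod c) by (pose proof (Cmod_ge_0 c); lra).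
  exists (r / (1 + Cmod c)). split; [now apply Rdiv_lt_0_compat|]. intros h Hh.
  apply Rlt_div_r in Hh; [|exact Hc].
  assert (Hh' : Cmod (c * h) < r).
  { rewrite Cmod_mult. pose proof (Cmod_ge_0 h). nra. }
  eapply is_series_C_ext; [| |exact (H _ Hh')].
  - intros n. cbv beta. rewrite Cpow_mult_l. ring.
  - f_equal. ring.
Qed.

(** The terms at h = r/2 tend to 0, hence are bounded. A single [K] dominates both that bound and
    the inverse radius 2/r, so that later estimates carry one parameter. *)
Lemma expands_coef_bound f z0 a : expands f z0 a ->
  exists K, 0 < K /\ forall n, Cmod (a n) <= K * K ^ n.
Proof.
  intros [r [Hr H]].
  assert (Hh : Cmod (RtoC (r / 2)) < r) by (rewrite Cmod_R, Rabs_pos_eq; lra).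
  pose proof (proj1 (is_series_C _ _) (H _ Hh)) as [H1 H2].
  destruct (filterlim_bounded (V := R_NormedModule) (fun n => Re (a n * RtoC (r/2) ^ n)%C)) as [M1 HM1].
  { exists 0. exact (ex_series_lim_0 _ (ex_intro _ _ H1)). }
  destruct (filterlim_bounded (V := R_NormedModule) (fun n => Im (a n * RtoC (r/2) ^ n)%C)) as [M2 HM2].
  { exists 0. exact (ex_series_lim_0 _ (ex_intro _ _ H2)). }
  set (K := Rmax (M1 + M2) (2 / r)).
  assert (HrK : 2 / r <= K) by apply Rmax_r.
  assert (HMK : M1 + M2 <= K) by apply Rmax_l.
  assert (Hr2 : 0 < 2 / r) by (apply Rdiv_lt_0_compat; lra).
  exists K. split; [lra|]. intros n.
  assert (Hm : Cmod (a n * RtoC (r / 2) ^ n) <= K).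
  { specialize (HM1 n). specialize (HM2 n).
    change (norm ?x) with (Rabs x) in HM1. change (norm ?x) with (Rabs x) in HM2.
    destruct (a n * RtoC (r / 2) ^ n)%C as [x y]. simpl in *.
    replace (x, y) with (RtoC x + Ci * RtoC y)%C
      by (unfold Ci, RtoC, Cmult, Cplus; simpl; f_equal; ring).
    eapply Rle_trans; [apply Cmod_triangle|].
    rewrite Cmod_mult, Cmod_Ci, !Cmod_R. lra. }
  rewrite Cmod_mult, Cmod_pow, Cmod_R, (Rabs_pos_eq (r / 2)) in Hm by lra.
  replace (Cmod (a n)) with (Cmod (a n) * (r / 2) ^ n * (2 / r) ^ n).
  - apply Rmult_le_compat; [|apply pow_le; lra|exact Hm|apply pow_incr; lra].
    apply Rmult_le_pos; [apply Cmod_ge_0|apply pow_le; lra].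
  - rewrite Rmult_assoc, <- Rpow_mult_distr.
    replace (r / 2 * (2 / r)) with 1 by (field; lra). rewrite pow1. ring.
Qed.

Lemma ex_series_scal_geom (K q : R) : Rabs q < 1 -> ex_series (fun n => K * q ^ n).
Proof.
  intros Hq. apply (ex_series_scal (V := R_NormedModule) K (fun n => q ^ n)). now apply ex_series_geom.
Qed.

Lemma coef_bound_term (a : nat -> C) K h n : (forall n, Cmod (a n) <= K * K ^ n) ->
  Cmod (a n * h ^ n) <= K * (K * Cmod h) ^ n.
Proof.
  intros Ha. rewrite Cmod_mult, Cmod_pow, Rpow_mult_distr, <- Rmult_assoc.
  apply Rmult_le_compat_r; [apply pow_le, Cmod_ge_0|apply Ha].
Qed.

(** Cauchy products need absolute convergence; the coefficient bound gives it on the possibly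
    smaller disc of radius 1/K. *)
Lemma expands_summable f z0 a : expands f z0 a ->
  exists r, 0 < r /\ forall h, Cmod h < r -> ex_series (fun n => Cmod (a n * h ^ n)%C).
Proof.
  intros H. destruct (expands_coef_bound _ _ _ H) as [K [HK Ha]].
  exists (/ K). split; [now apply Rinv_0_lt_compat|]. intros h Hh.
  assert (HKh : K * Cmod h < 1).
  { replace 1 with (K * / K) by (field; lra). now apply Rmult_lt_compat_l. }
  refine (ex_series_le (V := R_CompleteNormedModule) _ (fun n => K * (K * Cmod h) ^ n) _ _).
  - intros n. eapply Rle_trans; [apply Req_le, Rabs_pos_eq, Cmod_ge_0|].
    now apply coef_bound_term.
  - apply ex_series_scal_geom. rewrite Rabs_pos_eq; [exact HKh|].
    apply Rmult_le_pos; [lra|apply Cmod_ge_0].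
Qed.

Lemma expands_mult f g z0 a b : expands f z0 a -> expands g z0 b ->
  expands (fun z => f z * g z)%C z0 (fun n => sum_n (fun k => a k * b (n - k)%nat)%C n).
Proof.
  intros Hf Hg. destruct (expands_summable _ _ _ Hf) as [s [Hs Xa]].
  destruct (expands_summable _ _ _ Hg) as [s' [Hs' Xb]].
  destruct Hf as [r [Hr H]], Hg as [r' [Hr' H']].
  exists (Rmin (Rmin r r') (Rmin s s')). split; [now repeat apply Rmin_pos|].
  intros h Hh.
  assert (Hm : Cmod h < r /\ Cmod h < r' /\ Cmod h < s /\ Cmod h < s').
  { pose proof (Rmin_l (Rmin r r') (Rmin s s')). pose proof (Rmin_r (Rmin r r') (Rmin s s')).
    pose proof (Rmin_l r r'). pose proof (Rmin_r r r').
    pose proof (Rmin_l s s'). pose proof (Rmin_r s s'). lra. }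
  destruct Hm as (H1 & H2 & H3 & H4).
  eapply is_series_C_ext; [|reflexivity|exact (is_series_Cmult _ _ _ _ (H h H1) (H' h H2) (Xa h H3) (Xb h H4))].
  intros n. cbv beta. rewrite (Cmult_comm _ (h ^ n)), <- sum_n_Cmult. apply sum_n_ext_loc.
  intros k Hk. assert (E : (h ^ n)%C = (h ^ k * h ^ (n - k))%C)
    by (rewrite <- Cpow_add_r; f_equal; lia).
  rewrite E. eqC. ring.
Qed.

Lemma expands_remainder f z0 a m : expands f z0 a ->
  exists K r, 0 < K /\ 0 < r /\ forall h, Cmod h < r ->
    Cmod (f (z0 + h) - sum_n (fun n => a n * h ^ n)%C m)%C <= K * Cmod h ^ S m.
Proof.
  intros Hf. destruct (expands_coef_bound _ _ _ Hf) as [K [HK Ha]].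
  destruct Hf as [r [Hr H]].
  (* Below radius 1/(2K) the tail is dominated by a geometric series of ratio 1/2, whose sum
     contributes the factor 2. *)
  exists (2 * (K * K ^ S m)), (Rmin r (/ (2 * K))).
  assert (HK2 : 0 < / (2 * K)) by (apply Rinv_0_lt_compat; lra).
  split; [|split; [now apply Rmin_pos|]].
  { pose proof (pow_lt K (S m) HK). nra. }
  intros h Hh. pose proof (Rmin_l r (/ (2 * K))). pose proof (Rmin_r r (/ (2 * K))).
  assert (HKh : K * Cmod h <= 1 / 2).
  { replace (1 / 2) with (K * / (2 * K)) by (field; lra). apply Rmult_le_compat_l; lra. }
  set (u := fun n => (a n * h ^ n)%C) in *.
  assert (Hu : is_series (fun n => u (S m + n)%nat) (f (z0 + h) - sum_n u m)%C).
  { apply (is_series_incr_n (K := C_AbsRing) (V := C_NormedModule) u (S m)); [lia|].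
    simpl pred. eapply is_series_C_ext; [reflexivity| |apply H; lra].
    unfold plus; cbn -[Cminus]. eqC. ring. }
  pose proof (Cmod_ge_0 h) as Hh0.
  replace (2 * (K * K ^ S m) * Cmod h ^ S m)
    with (K * (K * Cmod h) ^ S m * / (1 - 1 / 2)) by (rewrite Rpow_mult_distr; field).
  apply (Cmod_is_series_le _ (fun n => K * (K * Cmod h) ^ S m * (1 / 2) ^ n) _ _) with (2 := Hu).
  - intros n. eapply Rle_trans; [apply (coef_bound_term a K); exact Ha|].
    rewrite pow_add, <- Rmult_assoc. apply Rmult_le_compat_l.
    + apply Rmult_le_pos; [lra|]. apply pow_le. nra.
    + apply pow_incr. split; nra.
  - apply (is_series_scal (V := R_NormedModule) (K * (K * Cmod h) ^ S m)).
    apply is_series_geom. rewrite Rabs_pos_eq; lra.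
Qed.

Lemma expands_continuous f z0 a : expands f z0 a ->
  forall eps, 0 < eps -> exists d, 0 < d /\
    forall h, Cmod h < d -> Cmod (f (z0 + h) - f z0)%C < eps.
Proof.
  intros Hf eps Heps. destruct (expands_remainder _ _ _ 0 Hf) as (K & r & HK & Hr & H).
  exists (Rmin r (eps / K)). split; [apply Rmin_pos; [lra|now apply Rdiv_lt_0_compat]|].
  intros h Hh. pose proof (Rmin_l r (eps / K)). pose proof (Rmin_r r (eps / K)).
  specialize (H h ltac:(lra)). rewrite sum_O in H. change (h ^ 0)%C with (RtoC 1) in H. rewrite Cmult_1_r in H.
  rewrite (expands_value _ _ _ Hf). simpl in H. rewrite Rmult_1_r in H.
  assert (Hh' : Cmod h < eps / K) by lra. apply Rlt_div_r in Hh'; lra.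
Qed.

Lemma expands_exp (s z0 : C) : exists a, expands (fun z => Cexp (s * z)%C) z0 a.
Proof.
  exists (fun n => (Cexp (s * z0) * (s ^ n * RtoC (/ INR (fact n))))%C).
  exists 1. split; [lra|]. intros h _.
  eapply is_series_C_ext; [| |exact (is_series_Cscal (Cexp (s * z0)) _ _ (is_series_exp (s * h)))].
  - intros n. cbv beta. rewrite Cpow_mult_l. ring.
  - rewrite <- Cexp_plus. f_equal. ring.
Qed.

Lemma Cmod_sum_n_le (u : nat -> C) (b : nat -> R) n :
  (forall k, (k <= n)%nat -> Cmod (u k) <= b k) -> Cmod (sum_n u n) <= sum_n b n.
Proof.
  induction n as [|n IH]; intros H; [rewrite !sum_O; now apply H|].
  rewrite !sum_Sn. eapply Rle_trans; [apply Cmod_triangle|].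
  apply Rplus_le_compat; [apply IH; intros k Hk|]; apply H; lia.
Qed.

(** * Reciprocal of a power series *)

Section Inverse.

Variable a : nat -> C.

(** The recursion for the reciprocal series uses all earlier coefficients; a table makes it
    structural. Row [m] is correct at indices up to [m] and repeats its entry [m] beyond. *)
Fixpoint inv_tab (m : nat) : nat -> C :=
  match m with
  | O => fun _ => (/ a 0%nat)%C
  | S p => fun k =>
      if Nat.leb k p then inv_tab p k
      else (- / a 0%nat * sum_n (fun j => inv_tab p j * a (S (p - j)))%C p)%C
  end.

Definition inv_coef (n : nat) : C := inv_tab n n.

Lemma inv_tab_stable m k : (k <= m)%nat -> inv_tab m k = inv_coef k.
Proof.
  induction m as [|m IH]; intros Hk.
  - now replace k with 0%nat by lia.
  - destruct (Nat.eq_dec k (S m)) as [->|Hne]; [reflexivity|].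
    simpl. rewrite (proj2 (Nat.leb_le k m)) by lia. apply IH; lia.
Qed.

Lemma inv_coef_S p :
  inv_coef (S p) = (- / a 0%nat * sum_n (fun j => inv_coef j * a (S (p - j)))%C p)%C.
Proof.
  unfold inv_coef at 1. cbn [inv_tab]. rewrite (proj2 (Nat.leb_gt (S p) p)) by lia.
  f_equal. apply sum_n_ext_loc. intros k Hk. now rewrite inv_tab_stable.
Qed.

Lemma inv_coef_convol n : a 0%nat <> 0 ->
  sum_n (fun k => inv_coef k * a (n - k)%nat)%C n = if Nat.eqb n 0 then RtoC 1 else RtoC 0.
Proof.
  intros Ha. destruct n as [|p].
  - rewrite sum_O. simpl. unfold inv_coef; simpl. field. exact Ha.
  - rewrite sum_Sn, Nat.sub_diag, inv_coef_S. simpl Nat.eqb. cbv iota.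
    rewrite (sum_n_ext_loc _ (fun j => inv_coef j * a (S (p - j)))%C).
    + unfold plus; simpl. field. exact Ha.
    + intros k Hk. now replace (S p - k)%nat with (S (p - k)) by lia.
Qed.

(** Closed form of the convolution of two geometric sequences, multiplied out so that K = L needs no
    separate case. *)
Lemma sum_geom_geom (K L : R) p :
  (L - K) * sum_n (fun j => L ^ j * K ^ (p - j)) p = L ^ S p - K ^ S p.
Proof.
  induction p as [|p IH].
  - rewrite sum_O. simpl. ring.
  - rewrite sum_Sn, Nat.sub_diag.
    rewrite (sum_n_ext_loc _ (fun j => K * (L ^ j * K ^ (p - j)))).
    + assert (E : sum_n (fun j => K * (L ^ j * K ^ (p - j))) p
              = K * sum_n (fun j => L ^ j * K ^ (p - j)) p)
        by exact (sum_n_mult_l (K := R_Ring) K _ p).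
      rewrite E. change plus with Rplus. rewrite Rmult_plus_distr_l.
      replace ((L - K) * (K * sum_n (fun j => L ^ j * K ^ (p - j)) p))
        with (K * ((L - K) * sum_n (fun j => L ^ j * K ^ (p - j)) p)) by ring.
      rewrite IH. simpl. ring.
    + intros k Hk. replace (S p - k)%nat with (S (p - k)) by lia. simpl. ring.
Qed.

(** The base L = K + beta K^2 is chosen so that L - K is exactly the factor beta K K produced by the
    recursion: the induction step then yields beta (L^(p+1) - K^(p+1)), which is at most beta
    L^(p+1). *)
Lemma inv_coef_bound K : 0 < K -> (forall n, Cmod (a n) <= K * K ^ n) ->
  let beta := Cmod (/ a 0%nat) in
  forall n, Cmod (inv_coef n) <= beta * (K + beta * K * K) ^ n.
Proof.
  intros HK Ha beta. set (L := K + beta * K * K).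
  assert (Hb : 0 <= beta) by apply Cmod_ge_0.
  assert (HL : K <= L) by (unfold L; assert (0 <= beta * K) by nra; nra).
  induction n as [n IH] using lt_wf_ind. destruct n as [|p].
  - unfold inv_coef; simpl. fold beta. lra.
  - rewrite inv_coef_S, Cmod_mult, Cmod_opp. fold beta.
    apply Rmult_le_compat_l; [exact Hb|].
    eapply Rle_trans.
    { apply (Cmod_sum_n_le _ (fun k => beta * K * K * (L ^ k * K ^ (p - k)))).
      intros k Hk. rewrite Cmod_mult.
      eapply Rle_trans; [apply Rmult_le_compat; [apply Cmod_ge_0|apply Cmod_ge_0|apply IH; lia|apply Ha]|].
      apply Req_le. fold L. simpl. ring. }
    assert (E : sum_n (fun k => beta * K * K * (L ^ k * K ^ (p - k))) p
              = beta * K * K * sum_n (fun k => L ^ k * K ^ (p - k)) p)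
      by exact (sum_n_mult_l (K := R_Ring) _ _ p).
    rewrite E. pose proof (sum_geom_geom K L p) as G.
    replace (L - K) with (beta * K * K) in G by (unfold L; ring).
    rewrite G. pose proof (pow_lt K (S p) HK). lra.
Qed.

End Inverse.

(** The formal reciprocal converges for |h| < 1/L, and its Cauchy product with the series of f is
    1. *)
Lemma analytic_inv f z0 : analytic_at f z0 -> f z0 <> 0 -> analytic_at (fun z => / f z)%C z0.
Proof.
  intros [a Hf] Hz. exists (inv_coef a).
  rewrite (expands_value _ _ _ Hf) in Hz.
  destruct (expands_coef_bound _ _ _ Hf) as [K [HK Ha]].
  pose proof (inv_coef_bound a K HK Ha) as Hb. cbv zeta in Hb.
  set (beta := Cmod (/ a 0%nat)) in *. set (L := K + beta * K * K) in *.
  assert (Hbeta : 0 <= beta) by apply Cmod_ge_0.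
  assert (HL : K <= L) by (unfold L; assert (0 <= beta * K) by nra; nra).
  destruct (expands_summable _ _ _ Hf) as [s [Hs Xa]]. destruct Hf as [r [Hr H]].
  exists (Rmin (/ L) (Rmin r s)).
  split; [repeat apply Rmin_pos; try lra; apply Rinv_0_lt_compat; lra|].
  intros h Hh.
  assert (Hm : Cmod h < / L /\ Cmod h < r /\ Cmod h < s).
  { pose proof (Rmin_l (/ L) (Rmin r s)). pose proof (Rmin_r (/ L) (Rmin r s)).
    pose proof (Rmin_l r s). pose proof (Rmin_r r s). lra. }
  destruct Hm as (H1 & H2 & H3).
  assert (HLh : L * Cmod h < 1).
  { replace 1 with (L * / L) by (field; lra). apply Rmult_lt_compat_l; lra. }
  pose proof (Cmod_ge_0 h) as Hh0.
  assert (Hbh : forall n, Cmod (inv_coef a n * h ^ n) <= beta * (L * Cmod h) ^ n).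
  { intros n. rewrite Cmod_mult, Cmod_pow, Rpow_mult_distr, <- Rmult_assoc.
    apply Rmult_le_compat_r; [now apply pow_le|apply Hb]. }
  assert (Xg : ex_series (fun n => beta * (L * Cmod h) ^ n)).
  { apply ex_series_scal_geom. rewrite Rabs_pos_eq; nra. }
  pose proof (CSeries_correct _ _ Hbh Xg) as Hg.
  set (g := CSeries _) in Hg.
  assert (Xb : ex_series (fun n => Cmod (inv_coef a n * h ^ n)%C)).
  { refine (ex_series_le (V := R_CompleteNormedModule) _ _ _ Xg).
    intros n. eapply Rle_trans; [apply Req_le, Rabs_pos_eq, Cmod_ge_0|]. apply Hbh. }
  pose proof (is_series_Cmult _ _ _ _ Hg (H h H2) Xb (Xa h H3)) as Hp.
  assert (E : (g * f (z0 + h))%C = 1).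
  { rewrite <- (CSeries_unique _ _ Hp).
    apply CSeries_unique. eapply is_series_C_ext; [|reflexivity|
      exact (is_series_at_0 (fun n => if Nat.eqb n 0 then RtoC 1 else RtoC 0))].
    intros n. cbv beta.
    transitivity (h ^ n * sum_n (fun k => inv_coef a k * a (n - k)%nat)%C n)%C.
    - rewrite inv_coef_convol by exact Hz. destruct n as [|n]; [simpl; eqC; ring|].
      simpl Nat.eqb. cbv iota. eqC. ring.
    - rewrite <- sum_n_Cmult. apply sum_n_ext_loc. intros k Hk.
      assert (E : (h ^ n)%C = (h ^ k * h ^ (n - k))%C)
        by (rewrite <- Cpow_add_r; f_equal; lia).
      rewrite E. eqC. ring. }
  (* That f has no zero near z0 comes from the product being 1, not from continuity. *)
  assert (Hf0 : f (z0 + h)%C <> 0).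
  { intros E0. rewrite E0, Cmult_0_r in E. apply RtoC_inj in E. lra. }
  replace (/ f (z0 + h))%C with g; [exact Hg|].
  replace g with (g * f (z0 + h) * / f (z0 + h))%C by (field; exact Hf0).
  rewrite E. ring.
Qed.

Lemma analytic_mult f g z0 : analytic_at f z0 -> analytic_at g z0 ->
  analytic_at (fun z => f z * g z)%C z0.
Proof. intros [a Ha] [b Hb]. eexists. exact (expands_mult _ _ _ _ _ Ha Hb). Qed.

Lemma analytic_plus f g z0 : analytic_at f z0 -> analytic_at g z0 ->
  analytic_at (fun z => f z + g z)%C z0.
Proof. intros [a Ha] [b Hb]. eexists. exact (expands_plus _ _ _ _ _ Ha Hb). Qed.

Lemma analytic_scal c f z0 : analytic_at f z0 -> analytic_at (fun z => c * f z)%C z0.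
Proof. intros [a Ha]. eexists. exact (expands_scal _ _ _ _ Ha). Qed.

Lemma analytic_ext f g z0 : (forall z, f z = g z) -> analytic_at f z0 -> analytic_at g z0.
Proof. intros H [a Ha]. exists a. now apply (expands_ext f). Qed.

Lemma analytic_comp_scal c f z0 : analytic_at f (c * z0)%C ->
  analytic_at (fun z => f (c * z)%C) z0.
Proof. intros [a Ha]. eexists. exact (expands_comp_scal _ _ _ _ Ha). Qed.

Lemma expands_shift f z0 a : expands (fun z => f (z0 + z)%C) 0 a -> expands f z0 a.
Proof.
  intros [r [Hr H]]. exists r. split; [exact Hr|]. intros h Hh.
  specialize (H h Hh). now rewrite Cplus_0_l in H.
Qed.

(** * Sums of exponentials *)

(** Re and Im are handled together as a functional [p] that is additive and bounded by the modulus,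
    followed by a squeeze. *)
Lemma is_series_of_remainder (w : nat -> C) (l : C) (e : nat -> R) :
  (forall N, Cmod (l - sum_n w N)%C <= e N) -> is_lim_seq e 0 -> is_series w l.
Proof.
  intros He H0. apply is_series_C.
  assert (Hsq : forall (p : C -> R) (u : nat -> R),
    (forall N, sum_n u N = p (sum_n w N)) ->
    (forall x y, p (x - y)%C = p x - p y) -> (forall x, Rabs (p x) <= Cmod x) ->
    is_series u (p l)).
  { intros p u Hu Hp Hb.
    assert (HL : is_lim_seq (sum_n u) (p l)); [|exact HL].
    apply (is_lim_seq_le_le (fun N => p l - e N) _ (fun N => p l + e N)).
    - intros N. rewrite Hu. specialize (Hb (l - sum_n w N)%C). rewrite Hp in Hb.
      specialize (He N).
      assert (Rabs (p l - p (sum_n w N)) <= e N) by lra.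
      apply Rabs_le_between in H. lra.
    - replace (Finite (p l)) with (Finite (p l - 0)) by (f_equal; ring).
      apply (is_lim_seq_minus' _ _ (p l) 0); [apply is_lim_seq_const|exact H0].
    - replace (Finite (p l)) with (Finite (p l + 0)) by (f_equal; ring).
      apply (is_lim_seq_plus' _ _ (p l) 0); [apply is_lim_seq_const|exact H0]. }
  split; apply Hsq.
  - intros N. now rewrite sum_n_C.
  - intros [x1 x2] [y1 y2]; reflexivity.
  - apply Rabs_Re_le.
  - intros N. now rewrite sum_n_C.
  - intros [x1 x2] [y1 y2]; reflexivity.
  - apply Rabs_Im_le.
Qed.

(** Interchange of summations. Cutting the inner index at N changes row r by at most B r q^(N+1) /
    (1 - q); summed over r this is q^(N+1) times a constant and tends to 0. *)
Lemma is_series_double (u : nat -> nat -> C) (B : nat -> R) (q : R) :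
  0 <= q < 1 -> (forall r n, Cmod (u r n) <= B r * q ^ n) -> ex_series B ->
  is_series (fun n => CSeries (fun r => u r n)) (CSeries (fun r => CSeries (u r))).
Proof.
  intros Hq Hu HB.
  assert (Hq' : Rabs q < 1) by (rewrite Rabs_pos_eq; lra).
  assert (HB0 : forall r, 0 <= B r).
  { intros r. specialize (Hu r 0%nat). simpl in Hu. pose proof (Cmod_ge_0 (u r 0%nat)). lra. }
  assert (Hrow : forall r, is_series (u r) (CSeries (u r))).
  { intros r. apply (CSeries_correct _ _ (Hu r)). now apply ex_series_scal_geom. }
  assert (Hrem : forall r N,
    Cmod (CSeries (u r) - sum_n (u r) N)%C <= q ^ S N * / (1 - q) * B r).
  { intros r N.
    assert (Ht : is_series (fun n => u r (S N + n)%nat) (CSeries (u r) - sum_n (u r) N)%C).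
    { apply (is_series_incr_n (K := C_AbsRing) (V := C_NormedModule) (u r) (S N)); [lia|].
      simpl pred. eapply is_series_C_ext; [reflexivity| |apply Hrow].
      unfold plus; cbn -[Cminus]. eqC. ring. }
    replace (q ^ S N * / (1 - q) * B r) with (B r * q ^ S N * / (1 - q)) by ring.
    apply (Cmod_is_series_le _ (fun n => B r * q ^ S N * q ^ n) _ _) with (2 := Ht).
    - intros n. eapply Rle_trans; [apply Hu|]. rewrite pow_add. apply Req_le; ring.
    - apply (is_series_scal (V := R_NormedModule) (B r * q ^ S N)).
      now apply is_series_geom. }
  assert (Hcol : forall n, is_series (fun r => u r n) (CSeries (fun r => u r n))).
  { intros n. apply (CSeries_correct _ (fun r => q ^ n * B r)).
    - intros r. rewrite Rmult_comm. apply Hu.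
    - now apply (ex_series_scal (V := R_NormedModule) (q ^ n) B). }
  assert (HT : forall N, is_series (fun r => sum_n (u r) N)
                 (sum_n (fun n => CSeries (fun r => u r n)) N)).
  { induction N as [|N IH].
    - eapply is_series_C_ext; [| |apply (Hcol 0%nat)]; [intros r|]; now rewrite sum_O.
    - eapply is_series_C_ext; [| |exact (is_series_Cplus _ _ _ _ IH (Hcol (S N)))];
        [intros r|]; now rewrite sum_Sn. }
  assert (HV : is_series (fun r => CSeries (u r)) (CSeries (fun r => CSeries (u r)))).
  { apply (CSeries_correct _ (fun r => / (1 - q) * B r)).
    - intros r. rewrite Rmult_comm.
      apply (Cmod_is_series_le (u r) (fun n => B r * q ^ n)); [apply Hu|apply Hrow|].
      apply (is_series_scal (V := R_NormedModule) (B r)). now apply is_series_geom.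
    - now apply (ex_series_scal (V := R_NormedModule) _ B). }
  apply (is_series_of_remainder _ _ (fun N => q ^ S N * / (1 - q) * Series B)).
  - intros N.
    apply (Cmod_is_series_le (fun r => CSeries (u r) - sum_n (u r) N)%C
             (fun r => q ^ S N * / (1 - q) * B r)); [intros r; apply Hrem| |].
    + pose proof (is_series_Cplus _ _ _ _ HV (is_series_Cscal (-1)%C _ _ (HT N))) as H.
      eapply is_series_C_ext; [| |exact H]; [intros r; cbv beta|]; eqC; ring.
    + apply (is_series_scal (V := R_NormedModule) (q ^ S N * / (1 - q))).
      now apply Series_correct.
  - replace (Finite 0) with (Rbar_mult (Finite (q * (/ (1 - q) * Series B))) (Finite 0))
      by (simpl; f_equal; ring).
    apply (is_lim_seq_ext (fun N => q * (/ (1 - q) * Series B) * q ^ N)).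
    { intros n. simpl. ring. }
    apply is_lim_seq_scal_l. now apply is_lim_seq_geom.
Qed.

Lemma pow_div_fact_le_exp x n : 0 <= x -> / INR (fact n) * x ^ n <= exp x.
Proof.
  intros Hx. pose proof (is_series_exp_R x) as H.
  assert (H0 : forall k, 0 <= / INR (fact k) * x ^ k).
  { intros k. apply Rmult_le_pos; [left; apply Rinv_0_lt_compat, INR_fact_lt_0|now apply pow_le]. }
  eapply Rle_trans.
  2: { apply (is_lim_seq_incr_compare (sum_n (fun k => / INR (fact k) * x ^ k)) (exp x) H) with (n := n).
       intros k. rewrite sum_Sn. unfold plus; simpl. specialize (H0 (S k)). simpl in H0. lra. }
  destruct n as [|n]; [rewrite sum_O; lra|]. rewrite sum_Sn.
  change (/ INR (fact (S n)) * x ^ S n <= sum_n (fun k : nat => / INR (fact k) * x ^ k) n + / INR (fact (S n)) * x ^ S n).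
  assert (0 <= sum_n (fun k : nat => / INR (fact k) * x ^ k) n).
  { clear - H0. induction n as [|n IH]; [rewrite sum_O; apply H0|].
    rewrite sum_Sn. specialize (H0 (S n)). change plus with Rplus. lra. }
  lra.
Qed.

Definition exp_sum (c s : nat -> C) (z : C) : C := CSeries (fun r => c r * Cexp (s r * z))%C.

(** Each exponential is expanded and the sums are exchanged. One term of an exponential series is at
    most its sum, so (|s r| rho)^n / n! <= exp(|s r| rho), and the double series has the majorant B
    r (|h| / rho)^n. The resulting power sums of the exponents are what becomes the q-series of
    [Eis]. *)
Lemma expands_exp_sum (c s : nat -> C) (rho : R) : 0 < rho ->
  ex_series (fun r => Cmod (c r) * exp (Cmod (s r) * rho)) ->
  expands (exp_sum c s) 0
    (fun n => RtoC (/ INR (fact n)) * CSeries (fun r => s r ^ n * c r))%C.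
Proof.
  intros Hrho HX. set (B := fun r => Cmod (c r) * exp (Cmod (s r) * rho)) in *.
  assert (Hs : forall r n, Cmod (c r) * (/ INR (fact n) * (Cmod (s r) * rho) ^ n) <= B r).
  { intros r n. apply Rmult_le_compat_l; [apply Cmod_ge_0|].
    apply pow_div_fact_le_exp. apply Rmult_le_pos; [apply Cmod_ge_0|lra]. }
  exists rho. split; [exact Hrho|]. intros h Hh. rewrite Cplus_0_l.
  pose proof (Cmod_ge_0 h) as Hh0.
  set (u := fun r n => (c r * ((s r * h) ^ n * RtoC (/ INR (fact n))))%C).
  assert (Hrow : forall r, CSeries (u r) = (c r * Cexp (s r * h))%C).
  { intros r. apply CSeries_unique, is_series_Cscal, is_series_exp. }
  assert (Hcol : forall n, CSeries (fun r => u r n) =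
    (RtoC (/ INR (fact n)) * CSeries (fun r => s r ^ n * c r) * h ^ n)%C).
  { intros n. apply CSeries_unique.
    assert (Hc : is_series (fun r => s r ^ n * c r)%C (CSeries (fun r => s r ^ n * c r)%C)).
    { apply (CSeries_correct _ (fun r => INR (fact n) * (/ rho) ^ n * B r)).
      - intros r. rewrite Cmod_mult, Cmod_pow.
        assert (Hr : 0 < (/ rho) ^ n) by (apply pow_lt, Rinv_0_lt_compat; lra).
        pose proof (INR_fact_lt_0 n) as Hn.
        replace (Cmod (s r) ^ n * Cmod (c r)) with (INR (fact n) * (/ rho) ^ n *
          (Cmod (c r) * (/ INR (fact n) * (Cmod (s r) * rho) ^ n))).
        + apply Rmult_le_compat_l; [|apply Hs]. apply Rmult_le_pos; lra.
        + rewrite Rpow_mult_distr.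
          replace (Cmod (s r) ^ n * Cmod (c r)) with
            (Cmod (s r) ^ n * Cmod (c r) * ((/ rho) * rho) ^ n)
            by (rewrite Rinv_l, pow1 by lra; ring).
          rewrite Rpow_mult_distr. field. lra.
      - now apply (ex_series_scal (V := R_NormedModule) _ B). }
    eapply is_series_C_ext; [| |exact (is_series_Cscal (RtoC (/ INR (fact n)) * h ^ n)%C _ _ Hc)].
    - intros r. unfold u. rewrite Cpow_mult_l. eqC. ring.
    - eqC; ring. }
  eapply is_series_C_ext; [intros n; apply Hcol| |].
  { apply CSeries_ext. exact Hrow. }
  apply (is_series_double u B (Cmod h / rho)); [split| |exact HX].
  - apply Rdiv_le_0_compat; lra.
  - apply Rlt_div_l; lra.
  - intros r n. unfold u. rewrite Cmod_mult, Cmod_exp_term, Cmod_mult.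
    eapply Rle_trans; [|apply Rmult_le_compat_r, (Hs r n)].
    + apply Req_le. unfold Rdiv. rewrite !Rpow_mult_distr, pow_inv. field.
      split; [apply pow_nonzero; lra|apply INR_fact_neq_0].
    + apply pow_le, Rdiv_le_0_compat; lra.
Qed.

(** Moving the centre to z0 only multiplies the coefficients by e^(s r z0), whose modulus accounts
    for the real part in the hypothesis. *)
Lemma analytic_exp_sum (c s : nat -> C) (z0 : C) (rho : R) : 0 < rho ->
  ex_series (fun r => Cmod (c r) * exp (Re (s r * z0) + Cmod (s r) * rho)) ->
  analytic_at (exp_sum c s) z0.
Proof.
  intros Hrho HX. eexists. apply expands_shift.
  eapply expands_ext; [|apply (expands_exp_sum (fun r => c r * Cexp (s r * z0))%C s rho Hrho)].
  - intros z. apply CSeries_ext. intros r. cbv beta.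
    rewrite <- Cmult_assoc, <- Cexp_plus. do 2 f_equal. ring.
  - eapply ex_series_ext; [|exact HX]. intros r. cbv beta.
    rewrite Cmod_mult, Cmod_Cexp, exp_plus. eqR. ring.
Qed.

(** * Maximum modulus *)

Lemma Cexp_pow (z : C) (n : nat) : (Cexp z ^ n)%C = Cexp (RtoC (INR n) * z).
Proof.
  induction n as [|n IH].
  - simpl. rewrite Cmult_0_l, Cexp_0. reflexivity.
  - rewrite Cpow_S, IH, <- Cexp_plus, S_INR, RtoC_plus. f_equal. ring.
Qed.

Lemma Cmod_Cexp_2PI (t : R) : Cmod (Cexp (2 * PI * Ci * t)) = 1.
Proof.
  rewrite Cexp_2PI. unfold Cmod; cbn [fst snd].
  rewrite Rplus_comm, <- !Rsqr_pow2, sin2_cos2. apply sqrt_1.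
Qed.

Lemma unit_root (w : C) (n : nat) : Cmod w = 1 ->
  exists o : C, Cmod o = 1 /\ (o ^ S n)%C = w.
Proof.
  intros Hw. destruct (twist_argP w Hw) as [_ E].
  exists (Cexp (2 * PI * Ci * RtoC (twist_arg w / INR (S n)))). split.
  - apply Cmod_Cexp_2PI.
  - rewrite Cexp_pow. rewrite E at 2. f_equal.
    replace (twist_arg w) with (INR (S n) * (twist_arg w / INR (S n))) at 2
      by (field; now apply not_0_INR).
    rewrite RtoC_mult. ring.
Qed.

Lemma Cunit_mult (z : C) : exists u, Cmod u = 1 /\ z = (RtoC (Cmod z) * u)%C.
Proof.
  destruct (Ceq_dec z 0) as [->|Hz].
  - exists (RtoC 1). rewrite Cmod_1, Cmod_0. split; [reflexivity|ring].
  - assert (Hm : RtoC (Cmod z) <> 0).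
    { intros H. apply RtoC_inj, Cmod_eq_0 in H. now apply Hz. }
    exists (z / RtoC (Cmod z))%C. split; [|field; exact Hm].
    rewrite Cmod_div by exact Hm. rewrite Cmod_R, Rabs_pos_eq by apply Cmod_ge_0.
    field. intros H. apply Hm. now rewrite H.
Qed.

Lemma sum_n_first_last (u : nat -> C) (n : nat) :
  (forall j, (j < n)%nat -> u (S j) = 0) -> sum_n u (S n) = (u 0%nat + u (S n))%C.
Proof.
  induction n as [|n IH]; intros H; rewrite sum_Sn.
  - now rewrite sum_O.
  - rewrite IH, H by (intros; apply H || lia; lia). rewrite Cplus_0_r. reflexivity.
Qed.

(* If a (S n) h^(S n) is the first non-constant term, h can be chosen so that it
   points in the direction of a 0, and then |f| exceeds |a 0| near z0. *)
Lemma expands_local_max f z0 a r : expands f z0 a -> 0 < r ->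
  (forall h, Cmod h < r -> Cmod (f (z0 + h)%C) <= Cmod (f z0)) ->
  forall n, a (S n) = 0.
Proof.
  intros Hf Hr Hmax n. induction n as [n IH] using lt_wf_ind.
  destruct (Ceq_dec (a (S n)) 0) as [E|Hn]; [exact E|exfalso].
  assert (Hn0 : 0 < Cmod (a (S n))) by now apply Cmod_gt_0.
  destruct (expands_remainder _ _ _ (S n) Hf) as (K & r' & HK & Hr' & Hrem).
  destruct (Cunit_mult (a 0%nat)) as (u & Hu & Ea).
  destruct (Cunit_mult (a (S n))) as (v & Hv & Ev).
  assert (Hv0 : v <> 0) by (intros E; rewrite E, Cmod_0 in Hv; lra).
  destruct (unit_root (u / v)%C n) as (o & Ho & Eo).
  { rewrite Cmod_div, Hu, Hv by exact Hv0. field. }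
  (* The bound |a (S n)| / K makes the remainder K t^(n+2) smaller than the gain |a (S n)| t^(n+1);
     halving makes all inequalities strict. If a 0 = 0, the direction [u] is an arbitrary unit
     vector, which is harmless. *)
  set (t := Rmin (Rmin r r') (Cmod (a (S n)) / K) / 2).
  assert (Hq : 0 < Cmod (a (S n)) / K) by now apply Rdiv_lt_0_compat.
  assert (Ht : 0 < t /\ t < r /\ t < r' /\ t < Cmod (a (S n)) / K).
  { pose proof (Rmin_l (Rmin r r') (Cmod (a (S n)) / K)).
    pose proof (Rmin_r (Rmin r r') (Cmod (a (S n)) / K)).
    pose proof (Rmin_l r r'). pose proof (Rmin_r r r').
    assert (0 < Rmin (Rmin r r') (Cmod (a (S n)) / K)) by now repeat apply Rmin_pos.
    unfold t. lra. }
  destruct Ht as (Ht & Htr & Htr' & HtK). apply Rlt_div_r in HtK; [|exact HK].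
  set (h := (RtoC t * o)%C).
  assert (Hh : Cmod h = t) by (unfold h; rewrite Cmod_mult, Ho, Cmod_R, Rabs_pos_eq; lra).
  specialize (Hmax h ltac:(lra)). specialize (Hrem h ltac:(lra)).
  rewrite sum_n_first_last in Hrem.
  2: { intros j Hj. rewrite (IH j Hj). apply Cmult_0_l. }
  change (h ^ 0)%C with (RtoC 1) in Hrem. rewrite Cmult_1_r, Hh in Hrem.
  rewrite (expands_value _ _ _ Hf) in Hmax.
  assert (Es : (a 0%nat + a (S n) * h ^ S n)%C =
               (RtoC (Cmod (a 0%nat) + Cmod (a (S n)) * t ^ S n) * u)%C).
  { unfold h. rewrite Cpow_mult_l, Eo, <- RtoC_pow, RtoC_plus, RtoC_mult.
    rewrite Ea at 1. rewrite Ev at 1. field. exact Hv0. }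
  pose proof (pow_lt t (S n) Ht) as Htn.
  assert (Hs : Cmod (a 0%nat + a (S n) * h ^ S n)%C = Cmod (a 0%nat) + Cmod (a (S n)) * t ^ S n).
  { rewrite Es, Cmod_mult, Hu, Cmod_R, Rabs_pos_eq; [ring|].
    pose proof (Cmod_ge_0 (a 0%nat)). nra. }
  pose proof (Cmod_triangle (f (z0 + h)%C) (- (f (z0 + h) - (a 0%nat + a (S n) * h ^ S n)))%C) as Htri.
  rewrite Cmod_opp in Htri.
  replace (f (z0 + h) + - (f (z0 + h) - (a 0%nat + a (S n) * h ^ S n)))%C
    with (a 0%nat + a (S n) * h ^ S n)%C in Htri by ring.
  rewrite Hs in Htri. change (t ^ S (S n)) with (t * t ^ S n) in Hrem. nra.
Qed.

Lemma expands_const f z0 a : expands f z0 a -> (forall n, a (S n) = 0) ->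
  exists r, 0 < r /\ forall h, Cmod h < r -> f (z0 + h)%C = f z0.
Proof.
  intros Hf Ha. pose proof (expands_value _ _ _ Hf) as E.
  destruct Hf as [r [Hr H]]. exists r. split; [exact Hr|]. intros h Hh.
  rewrite E, <- (CSeries_unique _ _ (H h Hh)). apply CSeries_unique.
  eapply is_series_C_ext; [|reflexivity|apply is_series_at_0].
  intros [|n]; [reflexivity|]. cbv beta. rewrite Ha. simpl. eqC. ring.
Qed.

(** Maximise in y for each x, then in x. The partial maximum is continuous in x by uniform
    continuity of f on the rectangle; the wider interval [a', b'] provides two-sided neighbourhoods
    of the end points a and b. *)
Lemma max_2d (f : R -> R -> R) (a' a b b' c d : R) :
  a' < a -> a <= b -> b < b' -> c <= d ->
  (forall x y, a' <= x <= b' -> c <= y <= d -> continuity_2d_pt f x y) ->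
  exists x0 y0, a <= x0 <= b /\ c <= y0 <= d /\
    forall x y, a <= x <= b -> c <= y <= d -> f x y <= f x0 y0.
Proof.
  intros Ha Hab Hb Hcd Hf.
  set (P := fun x y => c <= y <= d /\ forall y', c <= y' <= d -> f x y' <= f x y).
  set (Y := fun x => epsilon (inhabits 0) (P x)).
  assert (HY : forall x, a' <= x <= b' -> P x (Y x)).
  { intros x Hx. apply (epsilon_spec (inhabits 0) (P x)).
    destruct (continuity_ab_maj (f x) c d Hcd) as [y [Hy1 Hy2]].
    - intros y Hy. apply continuity_pt_locally. intros eps.
      destruct (Hf x y Hx Hy eps) as [de Hde]. exists de. intros v Hv.
      apply Hde; [|exact Hv]. rewrite Rminus_diag, Rabs_R0. apply cond_pos.
    - now exists y. }
  destruct (continuity_ab_maj (fun x => f x (Y x)) a b Hab) as [x0 [H1 H2]].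
  - intros x Hx. apply continuity_pt_locally. intros eps.
    destruct (uniform_continuity_2d f a' b' c d Hf eps) as [de Hde].
    assert (Hpos : 0 < Rmin de (Rmin (x - a') (b' - x))).
    { repeat apply Rmin_pos; try lra. apply cond_pos. }
    exists (mkposreal _ Hpos). intros u Hu.
    change (Rabs (u - x) < Rmin de (Rmin (x - a') (b' - x))) in Hu.
    pose proof (Rmin_l de (Rmin (x - a') (b' - x))). pose proof (Rmin_r de (Rmin (x - a') (b' - x))).
    pose proof (Rmin_l (x - a') (b' - x)). pose proof (Rmin_r (x - a') (b' - x)).
    assert (Hu' : a' <= u <= b').
    { assert (Rabs (u - x) < x - a') by lra. assert (Rabs (u - x) < b' - x) by lra.
      apply Rabs_def2 in H3. apply Rabs_def2 in H4. lra. }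
    destruct (HY x ltac:(lra)) as [Hx1 Hx2]. destruct (HY u Hu') as [Hu1 Hu2].
    assert (Hz : forall y, c <= y <= d -> Rabs (f u y - f x y) < eps).
    { intros y Hy. apply Hde; try lra. rewrite Rminus_diag, Rabs_R0. apply cond_pos. }
    pose proof (Hz _ Hx1) as Hz1. pose proof (Hz _ Hu1) as Hz2.
    apply Rabs_def2 in Hz1. apply Rabs_def2 in Hz2.
    specialize (Hx2 _ Hu1). specialize (Hu2 _ Hx1). apply Rabs_def1; lra.
  - destruct (HY x0 ltac:(lra)) as [Hx1 _].
    exists x0, (Y x0). repeat split; try lra. intros x y Hx Hy.
    destruct (HY x ltac:(lra)) as [_ Hx2].
    eapply Rle_trans; [now apply Hx2|]. now apply H1.
Qed.

(** Connectedness of an interval by calculus: the indicator [q] of the set where p takes the value p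
    t0 is locally constant, at points of the set by the local hypothesis and elsewhere by
    continuity, so its derivative is 0 and it is constant. *)
Lemma path_const (p : R -> C) (a b t0 : R) :
  a <= t0 <= b ->
  (forall t, a <= t <= b -> forall eps, 0 < eps -> exists d, 0 < d /\
     forall s, Rabs (s - t) < d -> Cmod (p s - p t)%C < eps) ->
  (forall t, a <= t <= b -> p t = p t0 -> exists d, 0 < d /\
     forall s, Rabs (s - t) < d -> p s = p t0) ->
  forall t, a <= t <= b -> p t = p t0.
Proof.
  intros H0 Hcont Hloc.
  set (q := fun t => if Ceq_dec (p t) (p t0) then 1 else 0).
  assert (Hq : forall t, a <= t <= b -> is_derive q t 0).
  { intros t Ht. apply (is_derive_ext_loc (fun _ => q t)).
    2: { apply (is_derive_const (V := R_NormedModule) (q t) t). }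
    unfold q at 1. destruct (Ceq_dec (p t) (p t0)) as [E|Hne].
    - destruct (Hloc t Ht E) as [d [Hd H]]. exists (mkposreal d Hd). intros s Hs.
      unfold q. rewrite (H s Hs). now destruct (Ceq_dec (p t0) (p t0)).
    - assert (He : 0 < Cmod (p t0 - p t)%C).
      { apply Cmod_gt_0. intros E. apply Hne.
        replace (p t) with (p t0 - (p t0 - p t))%C by ring. rewrite E. ring. }
      destruct (Hcont t Ht _ He) as [d [Hd H]]. exists (mkposreal d Hd). intros s Hs.
      unfold q. destruct (Ceq_dec (p s) (p t0)) as [E|]; [|reflexivity].
      specialize (H s Hs). rewrite E in H. lra. }
  assert (Hq0 : q t0 = 1) by (unfold q; now destruct (Ceq_dec (p t0) (p t0))).
  assert (Hqt : forall t, a <= t <= b -> q t = q t0).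
  { intros t Ht. destruct (Rtotal_order t t0) as [Hlt|[->|Hlt]]; [|reflexivity|].
    - apply (eq_is_derive (V := R_NormedModule) q t t0); [intros s Hs; apply Hq; lra|exact Hlt].
    - symmetry. apply (eq_is_derive (V := R_NormedModule) q t0 t); [intros s Hs; apply Hq; lra|exact Hlt]. }
  intros t Ht. specialize (Hqt t Ht). rewrite Hq0 in Hqt. unfold q in Hqt.
  destruct (Ceq_dec (p t) (p t0)) as [E|]; [exact E|lra].
Qed.

Lemma multiplier_0 (al v : C) : v = (al * v)%C -> al <> 1 -> v = 0.
Proof.
  intros H Hal. assert (H1 : (1 - al)%C <> 0).
  { intros E. apply Hal. replace al with (1 - (1 - al))%C by ring. rewrite E. ring. }
  replace v with ((v - al * v) / (1 - al))%C by (field; exact H1).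
  rewrite <- H. field. exact H1.
Qed.

(** * Quasi-periodic functions near a period parallelogram *)

Section Torus.

Variables (w1 w2 al be : C) (kap : R) (f : C -> C).

Let pt (x y : R) : C := (RtoC x * w1 + RtoC y * w2)%C.

Hypothesis Hkap : 0 < kap.
(** Real linear independence of the periods in quantitative form: small points have small
    coordinates. *)
Hypothesis Hcoord : forall h, exists u v, h = pt u v /\
  Rabs u <= kap * Cmod h /\ Rabs v <= kap * Cmod h.
Hypothesis Hal : Cmod al = 1.
Hypothesis Hbe : Cmod be = 1.
Hypothesis Hne : al <> 1 \/ be <> 1.
(** All hypotheses on f are confined to the open square, and the ranges of x and y in the two
    periodicity laws are those for which both points stay inside it. *)
Hypothesis Han : forall x y, -1 < x < 1 -> -1 < y < 1 -> analytic_at f (pt x y).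
Hypothesis Hper1 : forall x y, -1 < x < 0 -> -1 < y < 1 -> f (pt (x + 1) y) = (al * f (pt x y))%C.
Hypothesis Hper2 : forall x y, -1 < x < 1 -> -1 < y < 0 -> f (pt x (y + 1)) = (be * f (pt x y))%C.

Let pt_plus x y u v : pt (x + u) (y + v) = (pt x y + pt u v)%C.
Proof. unfold pt. rewrite !RtoC_plus. ring. Qed.

Let Cmod_pt u v : Cmod (pt u v) <= (Cmod w1 + Cmod w2) * Rmax (Rabs u) (Rabs v).
Proof.
  unfold pt. eapply Rle_trans; [apply Cmod_triangle|]. rewrite !Cmod_mult, !Cmod_R.
  pose proof (Cmod_ge_0 w1). pose proof (Cmod_ge_0 w2).
  pose proof (Rmax_l (Rabs u) (Rabs v)). pose proof (Rmax_r (Rabs u) (Rabs v)).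
  nra.
Qed.

Let pt_near x y d : 0 < d -> exists e, 0 < e /\ forall u v, Rabs (u - x) < e -> Rabs (v - y) < e ->
  exists h, Cmod h < d /\ pt u v = (pt x y + h)%C.
Proof.
  intros Hd. set (W := Cmod w1 + Cmod w2 + 1).
  assert (HW : 0 < W) by (unfold W; pose proof (Cmod_ge_0 w1); pose proof (Cmod_ge_0 w2); lra).
  exists (d / W). split; [now apply Rdiv_lt_0_compat|]. intros u v Hu Hv.
  exists (pt (u - x) (v - y)). split.
  - eapply Rle_lt_trans; [apply Cmod_pt|].
    assert (Hm : Rmax (Rabs (u - x)) (Rabs (v - y)) < d / W) by now apply Rmax_lub_lt.
    apply Rlt_div_r in Hm; [|exact HW].
    assert (0 <= Rmax (Rabs (u - x)) (Rabs (v - y)))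
      by (eapply Rle_trans; [apply Rabs_pos|apply Rmax_l]).
    unfold W in Hm. nra.
  - rewrite <- pt_plus. f_equal; ring.
Qed.

Let cont x y : -1 < x < 1 -> -1 < y < 1 -> forall eps, 0 < eps -> exists e, 0 < e /\
  forall u v, Rabs (u - x) < e -> Rabs (v - y) < e -> Cmod (f (pt u v) - f (pt x y))%C < eps.
Proof.
  intros Hx Hy eps Heps. destruct (Han x y Hx Hy) as [a Ha].
  destruct (expands_continuous _ _ _ Ha eps Heps) as [d [Hd H]].
  destruct (pt_near x y d Hd) as [e [He H']]. exists e. split; [exact He|].
  intros u v Hu Hv. destruct (H' u v Hu Hv) as [h [Hh ->]]. now apply H.
Qed.

(* |f| descends to the torus, hence has a maximum, where f is locally constant;
   so f is constant along both sides of the period parallelogram, which the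
   nontrivial multiplier only allows for the value 0. *)
Lemma quasiperiodic_analytic_0 x y : -1 < x < 1 -> -1 < y < 1 -> f (pt x y) = 0.
Proof.
  (* The square [-1/2, 1/2]^2 is a fundamental domain well inside (-1, 1)^2; 3/4 is the margin in x
     that [max_2d] asks for. *)
  destruct (max_2d (fun x y => Cmod (f (pt x y))) (-3/4) (-1/2) (1/2) (3/4) (-1/2) (1/2))
    as (x0 & y0 & Hx0 & Hy0 & Hmax); try lra.
  { intros u v Hu Hv eps.
    destruct (cont u v ltac:(lra) ltac:(lra) eps (cond_pos eps)) as [e [He H]].
    exists (mkposreal e He). intros u' v' Hu' Hv'.
    eapply Rle_lt_trans; [|exact (H u' v' Hu' Hv')].
    exact (norm_triangle_inv (V := C_NormedModule) (f (pt u' v')) (f (pt u v))). }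
  set (M := Cmod (f (pt x0 y0))) in Hmax.
  (* A coordinate outside [-1/2, 1/2] is moved back by one unit, first y and then, in [HM], x. The
     multipliers have modulus 1, so M bounds |f| on the whole open square. *)
  assert (Hm1 : forall u v, -1/2 <= u <= 1/2 -> -1 < v < 1 -> Cmod (f (pt u v)) <= M).
  { intros u v Hu Hv. destruct (Rle_lt_dec v (1/2)) as [H1|H1].
    - destruct (Rle_lt_dec (-1/2) v) as [H2|H2]; [apply Hmax; lra|].
      apply Rle_trans with (Cmod (f (pt u (v + 1)))); [|apply Hmax; lra].
      rewrite Hper2, Cmod_mult, Hbe by lra. lra.
    - replace v with (v - 1 + 1) by ring.
      rewrite Hper2, Cmod_mult, Hbe, Rmult_1_l by lra. apply Hmax; lra. }
  assert (HM : forall u v, -1 < u < 1 -> -1 < v < 1 -> Cmod (f (pt u v)) <= M).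
  { intros u v Hu Hv. destruct (Rle_lt_dec u (1/2)) as [H1|H1].
    - destruct (Rle_lt_dec (-1/2) u) as [H2|H2]; [apply Hm1; lra|].
      apply Rle_trans with (Cmod (f (pt (u + 1) v))); [|apply Hm1; lra].
      rewrite Hper1, Cmod_mult, Hal by lra. lra.
    - replace u with (u - 1 + 1) by ring.
      rewrite Hper1, Cmod_mult, Hal, Rmult_1_l by lra. apply Hm1; lra. }
  assert (Hloc : forall u v, -1/2 <= u <= 1/2 -> -1/2 <= v <= 1/2 ->
    f (pt u v) = f (pt x0 y0) -> exists e, 0 < e /\
    forall u' v', Rabs (u' - u) < e -> Rabs (v' - v) < e -> f (pt u' v') = f (pt x0 y0)).
  { intros u v Hu Hv E. destruct (Han u v ltac:(lra) ltac:(lra)) as [a Ha].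
    (* Within this radius the coordinates change by less than 1/2, so a disc around a point of the
       closed square remains where M is known to be a bound. *)
    assert (Hr : 0 < / (2 * kap)) by (apply Rinv_0_lt_compat; lra).
    destruct (expands_const _ _ _ Ha) as [r [Hr' Hc]].
    { apply (expands_local_max _ _ _ (/ (2 * kap)) Ha Hr). intros h Hh.
      rewrite E. destruct (Hcoord h) as (s & t & -> & Hs & Ht).
      assert (Hk : kap * Cmod (pt s t) < 1 / 2).
      { replace (1 / 2) with (kap * / (2 * kap)) by (field; lra).
        now apply Rmult_lt_compat_l. }
      rewrite <- pt_plus. apply Rabs_le_between in Hs. apply Rabs_le_between in Ht.
      apply HM; lra. }
    destruct (pt_near u v r Hr') as [e [He Hp]]. exists e. split; [exact He|].
    intros u' v' Hu' Hv'. destruct (Hp u' v' Hu' Hv') as [h [Hh ->]].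
    rewrite Hc by exact Hh. exact E. }
  assert (H00 : Rabs 0 = 0) by apply Rabs_R0.
  assert (Hpy : forall t, -1/2 <= t <= 1/2 -> f (pt x0 t) = f (pt x0 y0)).
  { apply (path_const (fun t => f (pt x0 t))); [exact Hy0| |].
    - intros t Ht eps Heps.
      destruct (cont x0 t ltac:(lra) ltac:(lra) eps Heps) as [e [He H]].
      exists e. split; [exact He|]. intros s Hs. apply H; [|exact Hs].
      rewrite Rminus_diag, H00. exact He.
    - intros t Ht E. destruct (Hloc x0 t Hx0 Ht E) as [e [He H]].
      exists e. split; [exact He|]. intros s Hs. apply H; [|exact Hs].
      rewrite Rminus_diag, H00. exact He. }
  assert (Hpx : forall t, -1/2 <= t <= 1/2 -> f (pt t y0) = f (pt x0 y0)).
  { apply (path_const (fun t => f (pt t y0))); [exact Hx0| |].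
    - intros t Ht eps Heps.
      destruct (cont t y0 ltac:(lra) ltac:(lra) eps Heps) as [e [He H]].
      exists e. split; [exact He|]. intros s Hs. apply H; [exact Hs|].
      rewrite Rminus_diag, H00. exact He.
    - intros t Ht E. destruct (Hloc t y0 Ht Hy0 E) as [e [He H]].
      exists e. split; [exact He|]. intros s Hs. apply H; [exact Hs|].
      rewrite Rminus_diag, H00. exact He. }
  assert (Hv : f (pt x0 y0) = 0).
  { destruct Hne as [Hn|Hn].
    - apply (multiplier_0 al); [|exact Hn].
      pose proof (Hper1 (-1/2) y0 ltac:(lra) ltac:(lra)) as H.
      rewrite (Hpx (-1/2 + 1)), (Hpx (-1/2)) in H by lra. exact H.
    - apply (multiplier_0 be); [|exact Hn].
      pose proof (Hper2 x0 (-1/2) ltac:(lra) ltac:(lra)) as H.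
      rewrite (Hpy (-1/2 + 1)), (Hpy (-1/2)) in H by lra. exact H. }
  intros Hx Hy. apply Cmod_eq_0. apply Rle_antisym; [|apply Cmod_ge_0].
  rewrite <- Cmod_0, <- Hv. now apply HM.
Qed.

End Torus.

(** * The twisted Weierstrass function *)

Lemma is_series_Cgeom (w : C) : Cmod w < 1 -> is_series (fun n => (w ^ n)%C) (/ (1 - w))%C.
Proof.
  intros Hw. pose proof (Cmod_ge_0 w) as Hw0.
  assert (H1 : (1 - w)%C <> 0).
  { intros E. replace w with (1 - (1 - w))%C in Hw by ring. rewrite E in Hw.
    replace (1 - 0)%C with (RtoC 1) in Hw by ring. rewrite Cmod_1 in Hw. lra. }
  apply (is_series_of_remainder _ _ (fun N => Cmod w / Cmod (1 - w)%C * Cmod w ^ N)).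
  - intros N. apply Req_le.
    assert (E : sum_n (fun n => (w ^ n)%C) N = ((1 - w ^ S N) / (1 - w))%C).
    { induction N as [|N IH]; [rewrite sum_O; simpl; field; exact H1|].
      rewrite sum_Sn, IH, !Cpow_S. unfold plus; simpl. field. exact H1. }
    rewrite E. replace (/ (1 - w) - (1 - w ^ S N) / (1 - w))%C with (w ^ S N / (1 - w))%C
      by (field; exact H1).
    rewrite Cmod_div, Cmod_pow by exact H1. simpl. unfold Rdiv. ring.
  - replace (Finite 0) with (Rbar_mult (Finite (Cmod w / Cmod (1 - w)%C)) (Finite 0))
      by (simpl; f_equal; ring).
    apply is_lim_seq_scal_l, is_lim_seq_geom. rewrite Rabs_pos_eq; lra.
Qed.

Lemma Re_RtoC_mult (x : R) (z : C) : Re (RtoC x * z) = x * Re z.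
Proof. destruct z; simpl; ring. Qed.

Lemma Re_2PIi_mult (z : C) : Re (2 * PI * Ci * z)%C = - (2 * PI * Im z).
Proof. destruct z; simpl; ring. Qed.

Lemma Cmod_qpow tau x : Cmod (qpow tau x) = exp (- (2 * PI * Im tau * x)).
Proof.
  unfold qpow. rewrite Cmod_Cexp. f_equal.
  replace (2 * PI * Ci * x * tau)%C with (RtoC x * (2 * PI * Ci * tau))%C by ring.
  rewrite Re_RtoC_mult, Re_2PIi_mult. ring.
Qed.

Lemma Cexp_2PIi : Cexp (2 * PI * Ci) = 1.
Proof.
  replace (2 * PI * Ci)%C with (2 * PI * Ci * RtoC 1)%C by ring.
  now rewrite Cexp_2PI, Rmult_1_r, cos_2PI, sin_2PI.
Qed.

Lemma exp_le_compat (x y : R) : x <= y -> exp x <= exp y.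
Proof. intros [H| ->]; [left; now apply exp_increasing|apply Rle_refl]. Qed.

Lemma exp_pow_INR (x : R) (n : nat) : exp x ^ n = exp (INR n * x).
Proof.
  induction n as [|n IH]; [now rewrite Rmult_0_l, exp_0|].
  simpl pow. rewrite IH, <- exp_plus, S_INR. f_equal. ring.
Qed.

(** * One-sided exponential sums *)

Section HalfSum.

Variables (u : C) (al : R) (tau : C).

Definition half_exponent (r : nat) : C := RtoC (INR r + al).

(** Used with (u, al) = (theta^(-1), lam) for the first q-series of [Eis], and with (theta, 1 - lam)
    for the second, where r + (1 - lam) = (r + 1) - lam. *)
Definition half_ratio (r : nat) : C := (u * qpow tau (INR r + al))%C.

Definition half_sum : C -> C :=
  exp_sum (fun r => half_ratio r / (1 - half_ratio r))%C half_exponent.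

(* Converges for Re z < 0 only, where it is the translate of [half_sum] by the
   period 2 pi i tau, see [half_sum_ext_shift]. *)
Definition half_sum_ext : C -> C :=
  exp_sum (fun r => / (1 - half_ratio r))%C half_exponent.

Let T : R := 2 * PI * Im tau.

Hypothesis Htau : 0 < Im tau.
Hypothesis Hu : Cmod u = 1.
Hypothesis Hal : 0 <= al.
Hypothesis Hnd : 0 < al \/ u <> 1.

Let HT : 0 < T.
Proof. unfold T. pose proof PI_RGT_0. apply Rmult_lt_0_compat; lra. Qed.

Let Cmod_ratio r : Cmod (half_ratio r) = exp (- (T * (INR r + al))).
Proof. unfold half_ratio. rewrite Cmod_mult, Hu, Cmod_qpow. fold T. ring. Qed.

(** The modulus exp(- T (r + al)) is 1 only for r = 0 and al = 0, and there the ratio is u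
    itself. *)
Lemma half_ratio_neq1 r : (1 - half_ratio r)%C <> 0.
Proof.
  intros E. assert (E1 : half_ratio r = 1).
  { replace (half_ratio r) with (1 - (1 - half_ratio r))%C by ring. rewrite E. ring. }
  assert (E2 : exp (- (T * (INR r + al))) = exp 0).
  { rewrite <- Cmod_ratio, E1, exp_0. apply Cmod_1. }
  apply exp_inv in E2.
  assert (E3 : INR r + al = 0) by (apply (Rmult_eq_reg_l T); lra).
  pose proof (pos_INR r). destruct Hnd as [H1|H1]; [lra|]. apply H1.
  unfold half_ratio, qpow in E1. rewrite E3 in E1.
  replace (2 * PI * Ci * 0 * tau)%C with (RtoC 0) in E1 by ring.
  rewrite Cexp_0, Cmult_1_r in E1. exact E1.
Qed.

(** Starting at index 1 makes the exponent at least 1, so the denominator is at least 1 - exp(- T)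
    uniformly; the term r = 0 has no such bound and is split off. *)
Let coef_bound r : Cmod (half_ratio (S r) / (1 - half_ratio (S r)))%C
  <= exp (- (T * (INR (S r) + al))) / (1 - exp (- T)).
Proof.
  pose proof (half_ratio_neq1 (S r)) as H1.
  rewrite Cmod_div, Cmod_ratio by exact H1.
  assert (He : exp (- T) < 1) by (rewrite <- exp_0; apply exp_increasing; lra).
  apply Rmult_le_compat_l; [left; apply exp_pos|].
  apply Rinv_le_contravar; [lra|].
  pose proof (Cmod_triangle (1 - half_ratio (S r)) (half_ratio (S r))) as Ht.
  replace (1 - half_ratio (S r) + half_ratio (S r))%C with (RtoC 1) in Ht by ring.
  rewrite Cmod_1, Cmod_ratio in Ht.
  assert (Hle : exp (- (T * (INR (S r) + al))) <= exp (- T)).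
  { apply exp_le_compat. rewrite S_INR. pose proof (pos_INR r). nra. }
  lra.
Qed.

(** Half of the distance from Re z to the abscissa T is spent on the radius of expansion rho; as Re
    z - T + rho = - rho, what remains still decays like exp(- rho r). *)
Lemma half_sum_summable (z : C) : Re z < T ->
  ex_series (fun r => Cmod (half_ratio r / (1 - half_ratio r))%C *
    exp (Re (half_exponent r * z) + Cmod (half_exponent r) * ((T - Re z) / 2))).
Proof.
  intros Hz. apply (ex_series_incr_1 (V := R_NormedModule)).
  set (rho := (T - Re z) / 2). assert (Hrho : 0 < rho) by (unfold rho; lra).
  assert (He : exp (- T) < 1) by (rewrite <- exp_0; apply exp_increasing; lra).
  refine (ex_series_le (V := R_CompleteNormedModule) _
            (fun r => / (1 - exp (- T)) * exp (- rho) ^ r) _ _).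
  - intros r.
    eapply Rle_trans; [apply Req_le, Rabs_pos_eq, Rmult_le_pos;
      [apply Cmod_ge_0|left; apply exp_pos]|].
    eapply Rle_trans; [apply Rmult_le_compat_r; [left; apply exp_pos|apply coef_bound]|].
    unfold half_exponent. rewrite Re_RtoC_mult, Cmod_R, Rabs_pos_eq
      by (pose proof (pos_INR (S r)); lra).
    unfold Rdiv at 1. rewrite (Rmult_comm _ (/ _)), Rmult_assoc, <- exp_plus.
    apply Rmult_le_compat_l; [left; apply Rinv_0_lt_compat; lra|].
    rewrite exp_pow_INR. apply exp_le_compat. rewrite S_INR. fold rho.
    replace (Re z) with (T - 2 * rho) by (unfold rho; lra).
    pose proof (pos_INR r). nra.
  - apply ex_series_scal_geom. rewrite Rabs_pos_eq by (left; apply exp_pos).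
    rewrite <- exp_0. apply exp_increasing. lra.
Qed.

Lemma half_sum_analytic (z : C) : Re z < T -> analytic_at half_sum z.
Proof.
  intros Hz. apply (analytic_exp_sum _ _ z ((T - Re z) / 2)); [lra|].
  now apply half_sum_summable.
Qed.

Lemma half_sum_expands_0 : expands half_sum 0
  (fun n => RtoC (/ INR (fact n)) * CSeries (fun r =>
      half_exponent r ^ n * (half_ratio r / (1 - half_ratio r))))%C.
Proof.
  apply (expands_exp_sum _ _ ((T - Re 0) / 2)).
  - simpl. lra.
  - eapply ex_series_ext; [|apply (half_sum_summable 0); simpl; lra].
    intros r. cbv beta. rewrite Cmult_0_r. simpl (Re 0). now rewrite Rplus_0_l.
Qed.

Lemma half_sum_is_series (z : C) : Re z < T ->
  is_series (fun r => half_ratio r / (1 - half_ratio r) * Cexp (half_exponent r * z))%C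
    (half_sum z).
Proof.
  intros Hz. apply (CSeries_correct _ _ (fun n => Rle_refl _)).
  refine (ex_series_le (V := R_CompleteNormedModule) _ _ _ (half_sum_summable z Hz)).
  intros r. eapply Rle_trans; [apply Req_le, Rabs_pos_eq, Cmod_ge_0|].
  rewrite Cmod_mult, Cmod_Cexp. apply Rmult_le_compat_l; [apply Cmod_ge_0|].
  apply exp_le_compat. pose proof (Cmod_ge_0 (half_exponent r)). nra.
Qed.

Lemma half_sum_shift_2PIi (z : C) : Re z < T ->
  half_sum (z + 2 * PI * Ci)%C = (Cexp (2 * PI * Ci * al) * half_sum z)%C.
Proof.
  intros Hz. apply CSeries_unique.
  eapply is_series_C_ext; [|reflexivity|exact (is_series_Cscal _ _ _ (half_sum_is_series z Hz))].
  intros r. cbv beta.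
  replace (Cexp (half_exponent r * (z + 2 * PI * Ci))) with
    (Cexp (2 * PI * Ci * al) * Cexp (half_exponent r * z))%C; [eqC; ring|].
  rewrite Cmult_plus_distr_l, Cexp_plus.
  replace (half_exponent r * (2 * PI * Ci))%C
    with (2 * PI * Ci * al + RtoC (INR r) * (2 * PI * Ci))%C
    by (unfold half_exponent; rewrite RtoC_plus; ring).
  rewrite Cexp_plus, <- Cexp_pow, Cexp_2PIi, Cpow_1_l. ring.
Qed.

(** At the exponent r + al the shift contributes q^(r + al), which is the missing numerator of the
    ratio up to the factor u. *)
Lemma half_sum_ext_shift (z : C) : Re z < T ->
  half_sum_ext (z + 2 * PI * Ci * tau)%C = (/ u * half_sum z)%C.
Proof.
  intros Hz. apply CSeries_unique.
  eapply is_series_C_ext; [|reflexivity|exact (is_series_Cscal _ _ _ (half_sum_is_series z Hz))].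
  intros r. cbv beta. unfold half_ratio at 1.
  replace (Cexp (half_exponent r * (z + 2 * PI * Ci * tau)))
    with (qpow tau (INR r + al) * Cexp (half_exponent r * z))%C.
  - eqC. field. split; [apply half_ratio_neq1|].
    intros E. rewrite E, Cmod_0 in Hu. lra.
  - unfold qpow, half_exponent. rewrite <- Cexp_plus. f_equal. ring.
Qed.

(** Since 1/(1 - w) = 1 + w/(1 - w), the two sums differ by the geometric series of e^((r + al) z).
    Its closed form is where the Bernoulli kernel, and with it the pole at 0, comes from. *)
Lemma half_sum_ext_eq (z : C) : Re z < 0 ->
  half_sum_ext z = (Cexp (al * z) / (1 - Cexp z) + half_sum z)%C.
Proof.
  intros Hz.
  assert (Hm : Cmod (Cexp z) < 1).
  { rewrite Cmod_Cexp, <- exp_0. now apply exp_increasing. }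
  apply CSeries_unique.
  eapply is_series_C_ext; [| |exact (is_series_Cplus _ _ _ _
     (is_series_Cscal (Cexp (al * z)) _ _ (is_series_Cgeom _ Hm))
     (half_sum_is_series z ltac:(lra)))]; [|reflexivity].
  intros r. cbv beta. rewrite Cexp_pow.
  replace (Cexp (half_exponent r * z)) with (Cexp (al * z) * Cexp (INR r * z))%C.
  - eqC. field. apply half_ratio_neq1.
  - unfold half_exponent. rewrite <- Cexp_plus, RtoC_plus. f_equal. ring.
Qed.

End HalfSum.

Lemma Cexp_eq_1 (z : C) : Cexp z = 1 -> Re z = 0 /\ (Rabs (Im z) < 2 * PI -> Im z = 0).
Proof.
  intros E.
  assert (H0 : Re z = 0).
  { apply exp_inv. rewrite exp_0, <- Cmod_Cexp, E. apply Cmod_1. }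
  split; [exact H0|]. intros Hi.
  apply (f_equal Re) in E. unfold Cexp in E. simpl in E.
  rewrite H0, exp_0, Rmult_1_l in E.
  (* From cos y = 1 - 2 sin(y/2)^2; as |y/2| < pi, the sine vanishes only at 0. *)
  assert (Hs : sin (Im z / 2) = 0).
  { replace (Im z) with (2 * (Im z / 2)) in E by field. rewrite cos_2a_sin in E. nra. }
  apply Rabs_def2 in Hi.
  destruct (Rtotal_order (Im z) 0) as [H|[H|H]]; [|exact H|].
  - pose proof (sin_gt_0 (- (Im z / 2)) ltac:(lra) ltac:(lra)) as Hp.
    rewrite sin_neg in Hp. lra.
  - pose proof (sin_gt_0 (Im z / 2) ltac:(lra) ltac:(lra)). lra.
Qed.

Section Kernel.

Variables (theta : C) (lam : R) (tau : C).

Definition bernoulli_kernel (z : C) : C := (Cexp (lam * z) / (Cexp z - 1))%C.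

(* P(z) for |Re z| < 2 pi Im tau: each term of the two-sided sum is split so that the
   pole at 0 is isolated in the Bernoulli kernel; the second sum runs over the
   negative exponents - (r + 1 - lam). *)
Definition twisted_weierstrass (z : C) : C :=
  (bernoulli_kernel z - half_sum (/ theta) lam tau z + half_sum theta (1 - lam) tau (- z))%C.

(** The value at 0 is the constant Taylor coefficient of the kernel minus 1/z, left as B_1 / 1! to
    match the general coefficient B_(n+1) / (n+1)!. *)
Definition twisted_weierstrass_reg (z : C) : C :=
  ((if Ceq_dec z 0 then RtoC (bernoulli 1 lam / INR (fact 1)) else bernoulli_kernel z - 1 / z)
   - half_sum (/ theta) lam tau z + half_sum theta (1 - lam) tau (- z))%C.

Let T : R := 2 * PI * Im tau.

Hypothesis Htau : 0 < Im tau.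
Hypothesis Htheta : Cmod theta = 1.
Hypothesis Hlam : 0 <= lam < 1.
Hypothesis Hnd : 0 < lam \/ theta <> 1.

Let theta_neq0 : theta <> 0.
Proof. intros E. rewrite E, Cmod_0 in Htheta. lra. Qed.

Let Hinv : Cmod (/ theta) = 1.
Proof. rewrite Cmod_inv by exact theta_neq0. rewrite Htheta. field. Qed.

Let Hnd1 : 0 < lam \/ (/ theta)%C <> 1.
Proof.
  destruct Hnd as [H|H]; [now left|right]. intros E. apply H.
  replace theta with (/ / theta)%C by (field; exact theta_neq0).
  rewrite E. field.
Qed.

Let Hlam' : 0 <= 1 - lam.
Proof. lra. Qed.

Let Hnd2 : 0 < 1 - lam \/ theta <> 1.
Proof. left; lra. Qed.

Let Re_opp (z : C) : Re (- z)%C = - Re z.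
Proof. reflexivity. Qed.

Lemma twisted_weierstrass_reg_eq (z : C) : z <> 0 -> twisted_weierstrass z = (/ z + twisted_weierstrass_reg z)%C.
Proof.
  intros Hz. unfold twisted_weierstrass, twisted_weierstrass_reg. destruct (Ceq_dec z 0) as [E|_]; [now elim Hz|].
  field. exact Hz.
Qed.

(** All exponents lie in lam + Z. In the last sum both the exponent 1 - lam and the argument - z
    reverse sign modulo integers, so the multiplier is the same there. *)
Lemma twisted_weierstrass_shift_2PIi (z : C) : Rabs (Re z) < T ->
  twisted_weierstrass (z + 2 * PI * Ci)%C = (Cexp (2 * PI * Ci * lam) * twisted_weierstrass z)%C.
Proof.
  intros Hz. apply Rabs_def2 in Hz. unfold twisted_weierstrass.
  rewrite half_sum_shift_2PIi by (assumption || (unfold T in *; lra)).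
  assert (E : half_sum theta (1 - lam) tau (- z)%C
    = (Cexp (- (2 * PI * Ci * lam)) * half_sum theta (1 - lam) tau (- (z + 2 * PI * Ci)))%C).
  { replace (- z)%C with (- (z + 2 * PI * Ci) + 2 * PI * Ci)%C at 1 by ring.
    rewrite half_sum_shift_2PIi; try assumption.
    - f_equal. replace (2 * PI * Ci * (1 - lam)%R)%C with (2 * PI * Ci + - (2 * PI * Ci * lam))%C
        by (rewrite RtoC_minus; ring).
      rewrite Cexp_plus, Cexp_2PIi. ring.
    - rewrite Re_opp, re_plus. replace (Re (2 * PI * Ci)) with 0 by (simpl; ring).
      fold T. lra. }
  rewrite E, Cexp_opp.
  assert (Ek : bernoulli_kernel (z + 2 * PI * Ci) = (Cexp (2 * PI * Ci * lam) * bernoulli_kernel z)%C).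
  { unfold bernoulli_kernel. rewrite (Cexp_plus z), Cexp_2PIi, Cmult_1_r.
    rewrite Cmult_plus_distr_l, Cexp_plus.
    replace (lam * (2 * PI * Ci))%C with (2 * PI * Ci * lam)%C by ring.
    unfold Cdiv. ring. }
  rewrite Ek. field. apply Cexp_neq0.
Qed.

(** The geometric series of the negative exponents has the same closed form as the kernel of the
    positive ones; the shift by tau relies on this. *)
Lemma bernoulli_kernel_opp (z : C) : Re z <> 0 ->
  (Cexp ((1 - lam)%R * - z) / (1 - Cexp (- z)))%C = bernoulli_kernel z.
Proof.
  intros Hz. unfold bernoulli_kernel.
  replace ((1 - lam)%R * - z)%C with (lam * z + - z)%C by (rewrite RtoC_minus; ring).
  rewrite Cexp_plus, Cexp_opp. field.
  assert (H : (Cexp z - 1)%C <> 0).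
  { intros E. apply Hz, Cexp_eq_1. replace (Cexp z) with (Cexp z - 1 + 1)%C by ring.
    rewrite E. ring. }
  split; [exact H|]. apply Cexp_neq0.
Qed.

(** Let z' = z + 2 pi i tau. Since Re z' < 0, the kernel at z' combines with the first half sum at
    z' into - theta times that half sum at z. Since Re (- z) < 0, the second half sum at z' is theta
    times the sum of the kernel at z and the second half sum at z. So the kernel disappears on one
    side and reappears on the other. *)
Lemma twisted_weierstrass_shift_tau (z : C) : 0 < Re z < T ->
  twisted_weierstrass (z + 2 * PI * Ci * tau)%C = (theta * twisted_weierstrass z)%C.
Proof.
  intros Hz.
  assert (HRe : Re (z + 2 * PI * Ci * tau)%C = Re z - T)
    by (rewrite re_plus, Re_2PIi_mult; unfold T; ring).
  pose proof (half_sum_ext_shift (/ theta) lam tau Htau Hinv (proj1 Hlam) Hnd1 z ltac:(fold T; lra)) as E1.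
  rewrite half_sum_ext_eq in E1; try assumption; try lra.
  pose proof (half_sum_ext_shift theta (1 - lam) tau Htau Htheta Hlam' Hnd2
    (- (z + 2 * PI * Ci * tau))%C ltac:(rewrite Re_opp, HRe; fold T; lra)) as E2.
  replace (- (z + 2 * PI * Ci * tau) + 2 * PI * Ci * tau)%C with (- z)%C in E2 by ring.
  rewrite half_sum_ext_eq, bernoulli_kernel_opp in E2; try assumption; try lra.
  2: { rewrite Re_opp; lra. }
  unfold twisted_weierstrass.
  replace (half_sum theta (1 - lam) tau (- (z + 2 * PI * Ci * tau)))
    with (theta * (/ theta * half_sum theta (1 - lam) tau (- (z + 2 * PI * Ci * tau))))%C
    by (field; exact theta_neq0).
  rewrite <- E2.
  assert (Hk : (1 - Cexp (z + 2 * PI * Ci * tau))%C <> 0).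
  { intros E. assert (H : Re (z + 2 * PI * Ci * tau)%C = 0); [|lra].
    apply Cexp_eq_1. replace (Cexp (z + 2 * PI * Ci * tau)) with
      (1 - (1 - Cexp (z + 2 * PI * Ci * tau)))%C by ring. rewrite E. ring. }
  assert (E3 : bernoulli_kernel (z + 2 * PI * Ci * tau)
    = (half_sum (/ theta) lam tau (z + 2 * PI * Ci * tau)
       - theta * half_sum (/ theta) lam tau z)%C).
  { replace (theta * half_sum (/ theta) lam tau z)%C with (/ / theta * half_sum (/ theta) lam tau z)%C
      by (f_equal; field; exact theta_neq0).
    rewrite <- E1. unfold bernoulli_kernel. field. split; [exact Hk|].
    intros E. apply Hk. replace (1 - Cexp (z + 2 * PI * Ci * tau))%C
      with (- (Cexp (z + 2 * PI * Ci * tau) - 1))%C by ring. rewrite E. ring. }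
  rewrite E3. ring.
Qed.

Lemma twisted_weierstrass_analytic (z : C) : Rabs (Re z) < T -> Cexp z <> 1 -> analytic_at twisted_weierstrass z.
Proof.
  intros Hz H1. apply Rabs_def2 in Hz. unfold twisted_weierstrass.
  apply analytic_plus; [apply analytic_plus|].
  - apply analytic_mult; [apply expands_exp|].
    apply (analytic_inv (fun z => Cexp z - 1)%C).
    + destruct (expands_exp 1 z) as [a Ha].
      (* The constant 1 is written as e^(0 z), so that only exponentials have to be expanded. *)
      apply (analytic_ext (fun z => Cexp (1 * z) + -1 * Cexp (0 * z))%C).
      { intros w. rewrite Cmult_1_l, Cmult_0_l, Cexp_0. ring. }
      apply analytic_plus; [apply expands_exp|]. apply analytic_scal, expands_exp.
    + intros E. apply H1. replace (Cexp z) with (Cexp z - 1 + 1)%C by ring. rewrite E. ring.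
  - apply (analytic_ext (fun z => -1 * half_sum (/ theta) lam tau z)%C); [intros; ring|].
    apply analytic_scal. apply half_sum_analytic; try assumption; fold T; lra.
  - apply (analytic_ext (fun z => half_sum theta (1 - lam) tau (-1 * z))%C).
    { intros w. f_equal. ring. }
    apply analytic_comp_scal. apply half_sum_analytic; try assumption.
    rewrite Re_RtoC_mult. fold T. lra.
Qed.

Lemma expands_bernoulli :
  expands (fun z => if Ceq_dec z 0 then RtoC (bernoulli 1 lam / INR (fact 1))
                    else bernoulli_kernel z - 1 / z)%C 0
    (fun n => RtoC (bernoulli (S n) lam / INR (fact (S n)))).
Proof.
  destruct (bernoulliP lam) as [_ [r [Hr H]]].
  exists r. split; [exact Hr|]. intros h Hh. rewrite Cplus_0_l.
  destruct (Ceq_dec h 0) as [->|Hh0].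
  - apply (is_series_at_0 (fun n => RtoC (bernoulli (S n) lam / INR (fact (S n))))).
  - apply H. split; [now apply Cmod_gt_0|exact Hh].
Qed.

End Kernel.

(** * The generating function of the Eisenstein series *)

Lemma twist_arg_nontrivial (theta phi : C) : Cmod phi = 1 ->
  (theta, phi) <> (RtoC 1, RtoC 1) -> 0 < twist_arg phi \/ theta <> 1.
Proof.
  intros Hphi Hne. destruct (twist_argP phi Hphi) as [Hl E].
  destruct (Rle_lt_or_eq_dec 0 (twist_arg phi) (proj1 Hl)) as [H|H]; [now left|right].
  intros Et. apply Hne. rewrite Et, E, <- H.
  replace (2 * PI * Ci * 0)%C with (RtoC 0) by ring. now rewrite Cexp_0.
Qed.

(** Coefficient n is B_(n+1)/(n+1)! minus the first q-series over n! plus (-1)^n times the second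
    over n!; the sign (-1)^n comes from the argument - z. Weight n + 1 goes with z^n. *)
Lemma twisted_weierstrass_reg_expands (theta phi tau : C) :
  0 < Im tau -> Cmod theta = 1 -> Cmod phi = 1 -> (theta, phi) <> (RtoC 1, RtoC 1) ->
  expands (twisted_weierstrass_reg theta (twist_arg phi) tau) 0 (fun n => - Eis (S n) (theta, phi) tau)%C.
Proof.
  intros Htau Ht Hp Hne. pose proof (twist_arg_nontrivial theta phi Hp Hne) as Hnd.
  destruct (twist_argP phi Hp) as [Hl _].
  set (lam := twist_arg phi) in *.
  assert (Ht0 : theta <> 0) by (intros E; rewrite E, Cmod_0 in Ht; lra).
  assert (Hinv : Cmod (/ theta) = 1) by (rewrite Cmod_inv, Ht by exact Ht0; field).
  assert (Hnd1 : 0 < lam \/ (/ theta)%C <> 1).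
  { destruct Hnd as [H|H]; [now left|right]. intros E. apply H.
    replace theta with (/ / theta)%C by (field; exact Ht0). rewrite E. field. }
  pose proof (half_sum_expands_0 (/ theta) lam tau Htau Hinv (proj1 Hl) Hnd1) as H1.
  assert (H2 : expands (half_sum theta (1 - lam) tau) (-1 * 0) (fun n =>
    RtoC (/ INR (fact n)) * CSeries (fun r => half_exponent (1 - lam) r ^ n *
      (half_ratio theta (1 - lam) tau r / (1 - half_ratio theta (1 - lam) tau r))))%C).
  { rewrite Cmult_0_r. apply half_sum_expands_0; try assumption; [lra|left; lra]. }
  pose proof (expands_plus _ _ _ _ _ (expands_bernoulli lam) (expands_plus _ _ _ _ _
    (expands_scal (-1) _ _ _ H1) (expands_comp_scal (-1) _ _ _ H2))) as H.
  eapply expands_coef_ext; [|refine (expands_ext _ _ _ _ _ H)].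
  - intros n. cbv beta. unfold Eis. fold lam.
    replace (S n - 1)%nat with n by lia.
    rewrite (CSeries_ext (fun r => half_exponent lam r ^ n *
        (half_ratio (/ theta) lam tau r / (1 - half_ratio (/ theta) lam tau r)))%C
      (fun r => RtoC ((INR r + lam) ^ n) * (/ theta * qpow tau (INR r + lam)) /
        (1 - / theta * qpow tau (INR r + lam)))%C).
    2: { intros r. unfold half_exponent, half_ratio. rewrite RtoC_pow. unfold Cdiv.
      eqC. ring. }
    rewrite (CSeries_ext (fun r => half_exponent (1 - lam) r ^ n *
        (half_ratio theta (1 - lam) tau r / (1 - half_ratio theta (1 - lam) tau r)))%C
      (fun s => RtoC ((INR (S s) - lam) ^ n) * (theta * qpow tau (INR (S s) - lam)) /
        (1 - theta * qpow tau (INR (S s) - lam)))%C).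
    2: { intros r. unfold half_exponent, half_ratio. rewrite RtoC_pow, S_INR.
      replace (INR r + 1 - lam) with (INR r + (1 - lam)) by ring. unfold Cdiv.
      eqC. ring. }
    unfold Rdiv. rewrite (RtoC_mult ((-1) ^ S n)), RtoC_pow, Cpow_S. ring.
  - intros z. cbv beta. unfold twisted_weierstrass_reg.
    replace (- z)%C with (-1 * z)%C by ring. ring.
Qed.

(** * The modular transformations *)

Lemma Im_opp_inv_pos (tau : C) : 0 < Im tau -> 0 < Im (- / tau).
Proof.
  destruct tau as [x y]. simpl. intros Hy.
  replace (- (- y / (x * (x * 1) + y * (y * 1)))) with (y / (x * (x * 1) + y * (y * 1)))
    by (field; nra).
  apply Rdiv_lt_0_compat; nra.
Qed.

Lemma C_neq0_of_Im (tau : C) : 0 < Im tau -> tau <> 0.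
Proof. intros H E. rewrite E in H. simpl in H. lra. Qed.

(** * The inversion of tau *)

Section Inversion.

Variables (theta phi tau : C).
Hypothesis Htheta : Cmod theta = 1.
Hypothesis Hphi : Cmod phi = 1.
Hypothesis Hne : (theta, phi) <> (RtoC 1, RtoC 1).
Hypothesis Htau : 0 < Im tau.

Let tau' : C := (- / tau)%C.
Let pt (x y : R) : C := (RtoC x * (2 * PI * Ci * tau) + RtoC y * (2 * PI * Ci))%C.
Let W1 : C -> C := twisted_weierstrass theta (twist_arg phi) tau.
Let W2 : C -> C := twisted_weierstrass (/ phi) (twist_arg theta) tau'.
(** With tau' = - 1/tau the polar parts 1/z and tau' (tau / z) cancel, so adding the regular parts
    alone gives a function that is analytic at 0 as well. *)
Let G (z : C) : C :=
  (twisted_weierstrass_reg theta (twist_arg phi) tau z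
   + tau' * twisted_weierstrass_reg (/ phi) (twist_arg theta) tau' (/ tau * z))%C.

Let tau_neq0 : tau <> 0.
Proof. exact (C_neq0_of_Im tau Htau). Qed.

Let phi_neq0 : phi <> 0.
Proof. intros E. rewrite E, Cmod_0 in Hphi. lra. Qed.

Let Hphi' : Cmod (/ phi) = 1.
Proof. rewrite Cmod_inv, Hphi by exact phi_neq0. field. Qed.

Let Htau' : 0 < Im tau'.
Proof. exact (Im_opp_inv_pos tau Htau). Qed.

Let Hne' : (/ phi, theta)%C <> (RtoC 1, RtoC 1).
Proof.
  intros E. apply Hne. pose proof (f_equal fst E) as E1. pose proof (f_equal snd E) as E2.
  cbn [fst snd] in E1, E2. f_equal; [exact E2|].
  replace phi with (/ / phi)%C by (field; exact phi_neq0). rewrite E1. field.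
Qed.

Let G_eq (z : C) : z <> 0 -> G z = (W1 z + tau' * W2 (/ tau * z))%C.
Proof.
  intros Hz. unfold G, W1, W2. rewrite !twisted_weierstrass_reg_eq.
  - unfold tau'. field. split; assumption.
  - intros E. apply Hz. replace z with (tau * (/ tau * z))%C by (field; exact tau_neq0).
    rewrite E. ring.
  - exact Hz.
Qed.

Let Re_pt x y : Re (pt x y) = - (2 * PI * Im tau * x).
Proof. unfold pt. destruct tau; simpl. ring. Qed.

(** Division by tau exchanges the periods, with a sign on the second; hence the twist (phi^(-1),
    theta) for [W2]. *)
Let pt_div x y : (/ tau * pt x y)%C = (RtoC x * (2 * PI * Ci) - RtoC y * (2 * PI * Ci * tau'))%C.
Proof. unfold pt, tau'. field. exact tau_neq0. Qed.

Let Re_pt_div x y : Re (/ tau * pt x y)%C = 2 * PI * Im tau' * y.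
Proof. rewrite pt_div. generalize tau'; intros [s t]; simpl. ring. Qed.

Let two_pi_pos : 0 < 2 * PI.
Proof. pose proof PI_RGT_0. lra. Qed.

Let T_pos : 0 < 2 * PI * Im tau.
Proof. apply Rmult_lt_0_compat; [exact two_pi_pos|exact Htau]. Qed.

Let T'_pos : 0 < 2 * PI * Im tau'.
Proof. apply Rmult_lt_0_compat; [exact two_pi_pos|exact Htau']. Qed.

Let Rabs_2pi t : -1 < t < 1 -> Rabs (2 * PI * t) < 2 * PI.
Proof. intros Ht. apply Rabs_def1; nra. Qed.

Let pt_0 : pt 0 0 = 0.
Proof. unfold pt. ring. Qed.

Let Cexp_pt x y : -1 < x < 1 -> -1 < y < 1 -> pt x y <> 0 -> Cexp (pt x y) <> 1.
Proof.
  intros Hx Hy Hz E. apply Hz. destruct (Cexp_eq_1 _ E) as [H1 H2].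
  rewrite Re_pt in H1. assert (Ex : x = 0) by (apply (Rmult_eq_reg_l (2 * PI * Im tau)); lra).
  subst x. assert (HI : Im (pt 0 y) = 2 * PI * y) by (unfold pt; simpl; ring).
  rewrite HI in H2. specialize (H2 (Rabs_2pi y Hy)).
  assert (Ey : y = 0) by (apply (Rmult_eq_reg_l (2 * PI)); lra).
  subst y. apply pt_0.
Qed.

Let Cexp_pt_div x y : -1 < x < 1 -> -1 < y < 1 -> pt x y <> 0 -> Cexp (/ tau * pt x y) <> 1.
Proof.
  intros Hx Hy Hz E. apply Hz. destruct (Cexp_eq_1 _ E) as [H1 H2].
  rewrite Re_pt_div in H1. assert (Ey : y = 0) by (apply (Rmult_eq_reg_l (2 * PI * Im tau')); lra).
  subst y. assert (HI : Im (/ tau * pt x 0)%C = 2 * PI * x).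
  { rewrite pt_div. generalize tau'; intros [s t]; simpl. ring. }
  rewrite HI in H2. specialize (H2 (Rabs_2pi x Hx)).
  assert (Ex : x = 0) by (apply (Rmult_eq_reg_l (2 * PI)); lra).
  subst x. apply pt_0.
Qed.

Let G_expands : expands G 0
  (fun n => - Eis (S n) (theta, phi) tau
            + tau' * (- Eis (S n) (/ phi, theta) tau' * (/ tau) ^ n))%C.
Proof.
  apply expands_plus; [now apply twisted_weierstrass_reg_expands|]. apply expands_scal.
  apply expands_comp_scal. rewrite Cmult_0_r. now apply twisted_weierstrass_reg_expands.
Qed.

Let Hl1 := proj1 (twist_argP phi Hphi).
Let Hl2 := proj1 (twist_argP theta Htheta).
Let Hn1 := twist_arg_nontrivial theta phi Hphi Hne.
Let Hn2 := twist_arg_nontrivial (/ phi) theta Htheta Hne'.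

Let G_analytic x y : -1 < x < 1 -> -1 < y < 1 -> analytic_at G (pt x y).
Proof.
  intros Hx Hy. destruct (Ceq_dec (pt x y) 0) as [E|Hz].
  { rewrite E. eexists. exact G_expands. }
  assert (HW : analytic_at (fun z => W1 z + tau' * W2 (/ tau * z))%C (pt x y)).
  { apply analytic_plus; [|apply analytic_scal, analytic_comp_scal]; apply twisted_weierstrass_analytic;
      try assumption.
    - rewrite Re_pt. apply Rabs_def1; nra.
    - now apply Cexp_pt.
    - rewrite Re_pt_div. apply Rabs_def1; nra.
    - now apply Cexp_pt_div. }
  destruct HW as [a Ha]. exists a.
  (* The disc of radius |pt x y| around this point avoids 0, so there G agrees with its expression
     through [W1] and [W2]. *)
  apply (expands_ext_loc _ _ _ _ (Cmod (pt x y))) with (3 := Ha); [now apply Cmod_gt_0|].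
  intros h Hh. symmetry. apply G_eq. intros E.
  assert (Eh : h = (- pt x y)%C).
  { transitivity (pt x y + h - pt x y)%C; [ring|]. rewrite E. ring. }
  rewrite Eh, Cmod_opp in Hh. lra.
Qed.

Let pt_neq0_x x y : x <> 0 -> pt x y <> 0.
Proof.
  intros Hx E. apply Hx. pose proof (Re_pt x y) as H. rewrite E in H.
  change (Re 0) with 0 in H. apply (Rmult_eq_reg_l (2 * PI * Im tau)); lra.
Qed.

Let pt_neq0_y x y : y <> 0 -> pt x y <> 0.
Proof.
  intros Hy E. apply Hy. pose proof (Re_pt_div x y) as H. rewrite E, Cmult_0_r in H.
  change (Re 0) with 0 in H.
  apply (Rmult_eq_reg_l (2 * PI * Im tau')); lra.
Qed.

(** A unit step in x is the tau-shift for [W1] and the shift by 2 pi i for [W2]; for - 1 < x < 0 the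
    real part of the starting point is in the strip that the tau-shift requires. *)
Let G_per1 x y : -1 < x < 0 -> -1 < y < 1 -> G (pt (x + 1) y) = (theta * G (pt x y))%C.
Proof.
  intros Hx Hy. rewrite !G_eq by (apply pt_neq0_x; lra).
  assert (E1 : W1 (pt (x + 1) y) = (theta * W1 (pt x y))%C).
  { unfold W1. rewrite <- twisted_weierstrass_shift_tau; try assumption.
    - f_equal. unfold pt. rewrite RtoC_plus. ring.
    - rewrite Re_pt. nra. }
  assert (E2 : W2 (/ tau * pt (x + 1) y) = (theta * W2 (/ tau * pt x y))%C).
  { unfold W2. rewrite (proj2 (twist_argP theta Htheta)) at 2.
    rewrite <- twisted_weierstrass_shift_2PIi; try assumption.
    - f_equal. rewrite !pt_div, RtoC_plus. ring.
    - rewrite Re_pt_div. apply Rabs_def1; nra. }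
  rewrite E1, E2. ring.
Qed.

(** Here [W2] undergoes the inverse of its tau'-shift, so its multiplier is the inverse of phi^(-1).
    The shift is therefore applied at the end point y + 1, where the real part is positive. *)
Let G_per2 x y : -1 < x < 1 -> -1 < y < 0 -> G (pt x (y + 1)) = (phi * G (pt x y))%C.
Proof.
  intros Hx Hy. rewrite !G_eq by (apply pt_neq0_y; lra).
  assert (E1 : W1 (pt x (y + 1)) = (phi * W1 (pt x y))%C).
  { unfold W1. rewrite (proj2 (twist_argP phi Hphi)) at 2.
    rewrite <- twisted_weierstrass_shift_2PIi; try assumption.
    - f_equal. unfold pt. rewrite RtoC_plus. ring.
    - rewrite Re_pt. apply Rabs_def1; nra. }
  assert (E2 : W2 (/ tau * pt x y) = (/ phi * W2 (/ tau * pt x (y + 1)))%C).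
  { unfold W2. rewrite <- twisted_weierstrass_shift_tau; try assumption.
    - f_equal. rewrite !pt_div, RtoC_plus. ring.
    - rewrite Re_pt_div. nra. }
  rewrite E1, E2. field. exact phi_neq0.
Qed.

(** Solves Re h = - 2 pi Im tau u and Im h = 2 pi (u Re tau + v). The constant adds up the bounds
    for both coordinates. *)
Let coord h : exists u v, h = pt u v /\
  Rabs u <= ((1 + Rabs (Re tau)) / (2 * PI * Im tau) + / (2 * PI)) * Cmod h /\
  Rabs v <= ((1 + Rabs (Re tau)) / (2 * PI * Im tau) + / (2 * PI)) * Cmod h.
Proof.
  pose proof (Rabs_Re_le h) as H1. pose proof (Rabs_Im_le h) as H2.
  pose proof (Rabs_pos (Re tau)) as H0. pose proof (Cmod_ge_0 h) as Hh.
  set (u := - Re h / (2 * PI * Im tau)). set (v := Im h / (2 * PI) - u * Re tau).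
  assert (Hi : 0 < / (2 * PI * Im tau)) by now apply Rinv_0_lt_compat.
  assert (Hi2 : 0 < / (2 * PI)) by now apply Rinv_0_lt_compat.
  assert (Hu : Rabs u <= / (2 * PI * Im tau) * Cmod h).
  { unfold u, Rdiv. rewrite Rabs_mult, Rabs_Ropp, (Rabs_pos_eq (/ _)) by lra. nra. }
  assert (Hv : Rabs v <= / (2 * PI) * Cmod h + Rabs u * Rabs (Re tau)).
  { unfold v. eapply Rle_trans; [apply Rabs_triang|]. rewrite Rabs_Ropp, Rabs_mult.
    apply Rplus_le_compat_r. unfold Rdiv. rewrite Rabs_mult, (Rabs_pos_eq (/ _)) by lra. nra. }
  exists u, v. unfold Rdiv. split; [|split].
  - assert (Eu : Re h = - (2 * PI * Im tau * u))
      by (unfold u; field; split; [lra|pose proof PI_RGT_0; lra]).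
    assert (Ev : Im h = 2 * PI * (u * Re tau + v))
      by (unfold v; field; pose proof PI_RGT_0; lra).
    unfold pt. clearbody u v. destruct h as [hx hy]. destruct tau as [s t].
    simpl in *. unfold Ci, RtoC, Cmult, Cplus; simpl. rewrite Eu, Ev. f_equal; ring.
  - assert (0 <= / (2 * PI * Im tau) * Cmod h) by nra. nra.
  - assert (0 <= / (2 * PI * Im tau) * Cmod h) by nra. nra.
Qed.

Lemma Eis_inversion (n : nat) :
  Eis (S n) (/ phi, theta)%C (- / tau)%C = (tau ^ S n * Eis (S n) (theta, phi) tau)%C.
Proof.
  set (kap := (1 + Rabs (Re tau)) / (2 * PI * Im tau) + / (2 * PI)) in coord.
  assert (Hkap : 0 < kap).
  { apply Rplus_lt_0_compat; [apply Rdiv_lt_0_compat; [pose proof (Rabs_pos (Re tau)); lra|exact T_pos]|].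
    now apply Rinv_0_lt_compat. }
  assert (Hne12 : theta <> 1 \/ phi <> 1).
  { destruct (Ceq_dec theta 1) as [E1|]; [|now left]. right. intros E2.
    apply Hne. now rewrite E1, E2. }
  pose proof (quasiperiodic_analytic_0 _ _ theta phi kap G Hkap coord Htheta Hphi Hne12
    G_analytic G_per1 G_per2) as H0.
  assert (Hk : 0 < / kap) by now apply Rinv_0_lt_compat.
  (* Radius 1/kap keeps both coordinates below 1 in absolute value. *)
  assert (HG : forall h, Cmod h < / kap -> G h = 0).
  { intros h Hh. destruct (coord h) as (u & v & E & Hu & Hv). rewrite E.
    assert (Hkh : kap * Cmod h < 1).
    { replace 1 with (kap * / kap) by (field; lra). now apply Rmult_lt_compat_l. }
    apply Rabs_le_between in Hu. apply Rabs_le_between in Hv. apply H0; lra. }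
  assert (Hcoef : forall n, (- Eis (S n) (theta, phi) tau
    + tau' * (- Eis (S n) (/ phi, theta) tau' * (/ tau) ^ n))%C = 0).
  { intros [|m].
    - rewrite <- (HG 0%C) by (rewrite Cmod_0; exact Hk).
      symmetry. exact (expands_value _ _ _ G_expands).
    - refine (expands_local_max _ _ _ (/ kap) G_expands Hk _ m).
      intros h Hh. rewrite Cplus_0_l, !HG by (assumption || (rewrite Cmod_0; exact Hk)).
      apply Rle_refl. }
  specialize (Hcoef n). fold tau'.
  assert (E : Eis (S n) (theta, phi) tau = (/ tau * (/ tau) ^ n * Eis (S n) (/ phi, theta) tau')%C).
  { replace (Eis (S n) (theta, phi) tau) with
      (Eis (S n) (theta, phi) tau + (- Eis (S n) (theta, phi) tau
    + tau' * (- Eis (S n) (/ phi, theta) tau' * (/ tau) ^ n)))%C by (rewrite Hcoef; ring).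
    unfold tau' at 1. ring. }
  rewrite E, Cpow_S, Cpow_inv by exact tau_neq0. field.
  split; [now apply Cpow_nz|exact tau_neq0].
Qed.

End Inversion.

(** * Angle coordinates and the action of SL(2, Z) *)

Lemma CpowZ_Cexp (z : C) (m : Z) : CpowZ (Cexp z) m = Cexp (RtoC (IZR m) * z).
Proof.
  destruct m as [|p|p]; simpl CpowZ.
  - now rewrite Cmult_0_l, Cexp_0.
  - rewrite Cexp_pow, INR_IZR_INZ, positive_nat_Z. reflexivity.
  - rewrite Cexp_pow, INR_IZR_INZ, positive_nat_Z, <- Cexp_opp. f_equal.
    change (Z.neg p) with (- Z.pos p)%Z. rewrite opp_IZR, RtoC_opp. ring.
Qed.

(** With theta = cis s and phi = cis t the multiplicative action of a matrix becomes its linear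
    action on (s, t), so products of matrices need no calculus of integer powers. *)
Definition cis (x : R) : C := Cexp (2 * PI * Ci * x).

Lemma cis_plus x y : cis (x + y) = (cis x * cis y)%C.
Proof. unfold cis. rewrite <- Cexp_plus, RtoC_plus. f_equal. ring. Qed.

Lemma cis_opp x : cis (- x) = (/ cis x)%C.
Proof. unfold cis. rewrite <- Cexp_opp, RtoC_opp. f_equal. ring. Qed.

Lemma cis_neq0 x : cis x <> 0.
Proof. apply Cexp_neq0. Qed.

Lemma CpowZ_cis x m : CpowZ (cis x) m = cis (IZR m * x).
Proof. unfold cis. rewrite CpowZ_Cexp, RtoC_mult. f_equal. ring. Qed.

Lemma cis_INR n : cis (INR n) = 1.
Proof.
  unfold cis. rewrite <- (Cpow_1_l n), <- Cexp_2PIi, Cexp_pow. f_equal. ring.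
Qed.

Lemma Cmod_cis x : Cmod (cis x) = 1.
Proof. apply Cmod_Cexp_2PI. Qed.

Lemma cis_surj (z : C) : Cmod z = 1 -> exists x, z = cis x.
Proof. intros H. exists (twist_arg z). apply (twist_argP z H). Qed.

(** Replacing tau by tau + q multiplies the exponential with exponent r + lam by e^(2 pi i q lam),
    the integer r dropping out. This is phi^q, which the change of theta cancels; phi, hence lam and
    the Bernoulli term, stay the same. *)
Lemma Eis_translation (k : nat) (s t : R) (q : Z) (tau : C) :
  Eis k (cis (s + IZR q * t), cis t) (tau + RtoC (IZR q)) = Eis k (cis s, cis t) tau.
Proof.
  unfold Eis. destruct (twist_argP (cis t) (Cmod_cis t)) as [_ E].
  set (lam := twist_arg (cis t)) in *. change (cis t = cis lam) in E.
  assert (Hq : forall x, qpow (tau + RtoC (IZR q)) x = (qpow tau x * CpowZ (cis x) q)%C).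
  { intros x. rewrite CpowZ_cis. unfold qpow, cis. rewrite <- Cexp_plus, RtoC_mult.
    f_equal. ring. }
  pose proof (cis_neq0 (IZR q * t)) as H1. pose proof (cis_neq0 s) as H2.
  f_equal; [f_equal|]; f_equal; apply CSeries_ext; intros r; rewrite Hq.
  - assert (Ex : (/ cis (s + IZR q * t) * (qpow tau (INR r + lam) * CpowZ (cis (INR r + lam)) q))%C
      = (/ cis s * qpow tau (INR r + lam))%C).
    { rewrite cis_plus, (cis_plus (INR r)), cis_INR, Cmult_1_l, <- E, CpowZ_cis.
      field. now split. }
    now rewrite Ex.
  - assert (Ex : (cis (s + IZR q * t) * (qpow tau (INR (S r) - lam) * CpowZ (cis (INR (S r) - lam)) q))%C
      = (cis s * qpow tau (INR (S r) - lam))%C).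
    { unfold Rminus at 2. rewrite cis_plus, (cis_plus (INR (S r))), cis_INR, Cmult_1_l, cis_opp, <- E.
      rewrite <- cis_opp, CpowZ_cis, Ropp_mult_distr_r_reverse, cis_opp. field. exact H1. }
    now rewrite Ex.
Qed.

Lemma Im_moebius (a b c d : Z) (tau : C) : (a * d - b * c = 1)%Z -> 0 < Im tau ->
  (RtoC (IZR c) * tau + RtoC (IZR d))%C <> 0 /\
  0 < Im ((RtoC (IZR a) * tau + RtoC (IZR b)) / (RtoC (IZR c) * tau + RtoC (IZR d))).
Proof.
  intros Hdet Hy. apply (f_equal IZR) in Hdet. rewrite minus_IZR, !mult_IZR in Hdet.
  generalize dependent (IZR a). generalize dependent (IZR b).
  generalize dependent (IZR c). generalize dependent (IZR d).
  intros d' c' b' a' Hdet. destruct tau as [x y]. simpl in Hy.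
  assert (Hpos : 0 < (c' * x + d') ^ 2 + (c' * y) ^ 2).
  { assert (H1 : 0 <= (c' * x + d') ^ 2) by apply pow2_ge_0.
    assert (H2 : 0 <= (c' * y) ^ 2) by apply pow2_ge_0.
    destruct (Req_dec c' 0) as [->|Hc].
    - assert (d' <> 0) by (intros ->; lra).
      assert (0 < (0 * x + d') ^ 2) by (apply pow2_gt_0; lra). lra.
    - assert (0 < (c' * y) ^ 2) by (apply pow2_gt_0, Rmult_integral_contrapositive; split; lra). lra. }
  split.
  - intros E. pose proof (f_equal Re E) as E1. pose proof (f_equal Im E) as E2.
    simpl in E1, E2. assert (c' * x + d' = 0) by lra. assert (c' * y = 0) by lra. nra.
  - assert (E : Im ((RtoC a' * (x, y) + RtoC b') / (RtoC c' * (x, y) + RtoC d'))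
      = y * / ((c' * x + d') ^ 2 + (c' * y) ^ 2)).
    { transitivity ((a' * d' - b' * c') * y * / ((c' * x + d') ^ 2 + (c' * y) ^ 2));
        [|rewrite Hdet; ring].
      unfold Im, RtoC, Cdiv, Cinv, Cmult, Cplus; cbn [fst snd]. field. lra. }
    rewrite E. apply Rmult_lt_0_compat; [exact Hy|now apply Rinv_0_lt_compat].
Qed.

(** The inverse matrix (d, -b; -c, a) is integral, so it carries a trivial pair back to a trivial
    pair. *)
Lemma cis_lattice (a b c d : Z) (s t : R) : (a * d - b * c = 1)%Z ->
  (cis s, cis t) <> (RtoC 1, RtoC 1) ->
  (cis (IZR a * s + IZR b * t), cis (IZR c * s + IZR d * t)) <> (RtoC 1, RtoC 1).
Proof.
  intros Hdet Hne E. apply Hne.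
  pose proof (f_equal fst E) as E1. pose proof (f_equal snd E) as E2. cbn [fst snd] in E1, E2.
  assert (H1 : forall m, CpowZ 1 m = 1).
  { intros m. rewrite <- Cexp_0, CpowZ_Cexp. f_equal. ring. }
  apply (f_equal IZR) in Hdet. rewrite minus_IZR, !mult_IZR in Hdet.
  assert (Hz : forall m n x y, cis x = 1 -> cis y = 1 -> cis (IZR m * x + IZR n * y) = 1).
  { intros m n x y Hx Hy. rewrite cis_plus, <- !CpowZ_cis, Hx, Hy, !H1. ring. }
  f_equal.
  - rewrite <- (Hz d (- b)%Z _ _ E1 E2). f_equal. rewrite opp_IZR.
    replace s with ((IZR a * IZR d - IZR b * IZR c) * s) at 1 by (rewrite Hdet; ring). ring.
  - rewrite <- (Hz (- c)%Z a _ _ E1 E2). f_equal. rewrite opp_IZR.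
    replace t with ((IZR a * IZR d - IZR b * IZR c) * t) at 1 by (rewrite Hdet; ring). ring.
Qed.

Lemma Eis_S (k : nat) (s t : R) (tau : C) : (1 <= k)%nat ->
  (cis s, cis t) <> (RtoC 1, RtoC 1) -> 0 < Im tau ->
  Eis k (cis (- t), cis s) (- / tau) = (tau ^ k * Eis k (cis s, cis t) tau)%C.
Proof.
  intros Hk Hne Htau. destruct k as [|n]; [lia|]. rewrite cis_opp.
  apply Eis_inversion; try assumption; apply Cmod_cis.
Qed.

(** The square of the inversion is - 1, and the two factors multiply to ((- 1/tau) tau)^k. A
    termwise proof would exchange lam with 1 - lam and treat lam = 0 apart. *)
Lemma Eis_opp (k : nat) (s t : R) (tau : C) : (1 <= k)%nat ->
  (cis s, cis t) <> (RtoC 1, RtoC 1) -> 0 < Im tau ->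
  Eis k (cis (- s), cis (- t)) tau = ((-1) ^ k * Eis k (cis s, cis t) tau)%C.
Proof.
  intros Hk Hne Htau. pose proof (C_neq0_of_Im _ Htau) as H0.
  pose proof (Im_opp_inv_pos _ Htau) as Htau'.
  assert (Hne' : (cis (- t), cis s) <> (RtoC 1, RtoC 1)).
  { pose proof (cis_lattice 0 (-1) 1 0 s t eq_refl Hne) as H.
    replace (0 * s + -1 * t) with (- t) in H by ring.
    replace (1 * s + 0 * t) with s in H by ring. exact H. }
  replace tau with (- / (- / tau))%C at 1 by (field; exact H0).
  rewrite Eis_S, Eis_S by assumption.
  rewrite Cmult_assoc, <- Cpow_mult_l. do 2 f_equal. field. exact H0.
Qed.

(* Euclid's algorithm on the first column: for c <> 0 and a = q c + r,
   (a b; c d) = T^q S (c d; -r -(b - q d)). *)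
Lemma Eis_modular (k : nat) (a b c d : Z) (s t : R) (tau : C) : (1 <= k)%nat ->
  (a * d - b * c = 1)%Z -> (cis s, cis t) <> (RtoC 1, RtoC 1) -> 0 < Im tau ->
  Eis k (cis (IZR a * s + IZR b * t), cis (IZR c * s + IZR d * t))
    ((RtoC (IZR a) * tau + RtoC (IZR b)) / (RtoC (IZR c) * tau + RtoC (IZR d))) =
  ((RtoC (IZR c) * tau + RtoC (IZR d)) ^ k * Eis k (cis s, cis t) tau)%C.
Proof.
  intros Hk. remember (Z.abs_nat c) as N eqn:HN. revert a b c d HN.
  induction N as [N IH] using lt_wf_ind. intros a b c d HN Hdet Hne Htau.
  destruct (Z.eq_dec c 0) as [->|Hc].
  - assert (Had : (a = 1 /\ d = 1 \/ a = -1 /\ d = -1)%Z).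
    { assert (H : (a * d = 1)%Z) by lia. pose proof (Z.eq_mul_1 a d H). nia. }
    destruct Had as [[-> ->]|[-> ->]].
    + replace (1 * s + IZR b * t) with (s + IZR b * t) by ring.
      replace (0 * s + 1 * t) with t by ring.
      replace ((1 * tau + RtoC (IZR b)) / (0 * tau + 1))%C with (tau + RtoC (IZR b))%C
        by (field; intros E; apply RtoC_inj in E; lra).
      rewrite Eis_translation. replace (0 * tau + 1)%C with (RtoC 1) by ring.
      rewrite Cpow_1_l. ring.
    (* The matrix (-1 b; 0 -1) is minus the translation by - b, so the translation is applied to the
       pair with both angles negated. *)
    + replace (-1 * s + IZR b * t) with (- s + IZR (- b) * - t) by (rewrite opp_IZR; ring).
      replace (0 * s + -1 * t) with (- t) by ring.
      replace ((-1 * tau + RtoC (IZR b)) / (0 * tau + -1))%C with (tau + RtoC (IZR (- b)))%C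
        by (rewrite opp_IZR, RtoC_opp; field; intros E; apply RtoC_inj in E; lra).
      rewrite Eis_translation, Eis_opp by assumption.
      do 2 f_equal. ring.
  - set (q := (a / c)%Z). set (r := (a mod c)%Z). set (e := (b - q * d)%Z).
    assert (Ha : a = (c * q + r)%Z) by (apply Z.div_mod; exact Hc).
    assert (Hdet' : (c * (- e) - d * (- r) = 1)%Z) by (unfold e; nia).
    (* The remainder takes the sign of c; in either case |r| < |c|. *)
    assert (Hr : (Z.abs_nat (- r) < N)%nat).
    { pose proof (Z.mod_bound_or a c Hc) as Hb. fold r in Hb. lia. }
    pose proof (IH _ Hr c d (- r)%Z (- e)%Z eq_refl Hdet' Hne Htau) as H1.
    destruct (Im_moebius _ _ _ _ _ Hdet' Htau) as [Hj' Him'].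
    destruct (Im_moebius _ _ _ _ _ Hdet Htau) as [Hj _].
    pose proof (cis_lattice _ _ _ _ s t Hdet' Hne) as Hne'.
    pose proof (Eis_S k _ _ _ Hk Hne' Him') as H2.
    rewrite H1 in H2.
    pose proof (Eis_translation k (- (IZR (- r) * s + IZR (- e) * t))
      (IZR c * s + IZR d * t) q
      (- / ((RtoC (IZR c) * tau + RtoC (IZR d)) / (RtoC (IZR (- r)) * tau + RtoC (IZR (- e)))))%C) as H3.
    rewrite H2 in H3.
    replace (IZR a * s + IZR b * t)
      with (- (IZR (- r) * s + IZR (- e) * t) + IZR q * (IZR c * s + IZR d * t)).
    2: { rewrite Ha. unfold e. rewrite !opp_IZR, minus_IZR, plus_IZR, !mult_IZR. ring. }
    rewrite Cmult_assoc, <- Cpow_mult_l in H3.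
    replace ((RtoC (IZR a) * tau + RtoC (IZR b)) / (RtoC (IZR c) * tau + RtoC (IZR d)))%C with
      (- / ((RtoC (IZR c) * tau + RtoC (IZR d)) / (RtoC (IZR (- r)) * tau + RtoC (IZR (- e))))
        + RtoC (IZR q))%C.
    (* Cocycle identity: the factor of the inversion is (c tau + d) / (- r tau - e), and multiplied
       by the factor - r tau - e of the smaller matrix it leaves c tau + d. *)
    + rewrite H3. do 2 f_equal. field. exact Hj'.
    + rewrite Ha. unfold e in Hj' |- *.
      rewrite !opp_IZR, minus_IZR, mult_IZR, !RtoC_opp, RtoC_minus, RtoC_mult in Hj' |- *.
      rewrite plus_IZR, mult_IZR, RtoC_plus, RtoC_mult. field. now split.
Qed.

Theorem proposition2p14 (theta phi : C) (k : nat)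
    (Htheta : Cmod theta = 1%R) (Hphi : Cmod phi = 1%R)
    (Hne : (theta, phi) <> (RtoC 1, RtoC 1)) (Hk : (1 <= k)%nat) :
  forall (g : SL2Z) (tau : C), (0 < Im tau)%R ->
    Eis k (act_twist g (theta, phi)) (moebius g tau) =
    (Cpow (automorphy g tau) k * Eis k (theta, phi) tau)%C.
Proof.
  intros [a b c d Hdet] tau Htau. unfold act_twist, moebius, automorphy; cbn [sl_a sl_b sl_c sl_d].
  destruct (cis_surj theta Htheta) as [s ->]. destruct (cis_surj phi Hphi) as [t ->].
  rewrite !CpowZ_cis, <- !cis_plus. now apply Eis_modular.
Qed.
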